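(* Let $D$ be a diagram such that either every column of $D$ contains at most one cell, or rows $1$ and $2$ of $D$ contain no cells. Then the following are equivalent: (1) $\mathcal{P}(D)$ is shellable; (2) $\mathcal{P}(D)$ is EL-shellable; (3) the Kohnert polynomial $\mathfrak{K}_D$ is multiplicity free.
   Context: A diagram is a finite set of cells in $\mathbb{Z}_{>0}\times\mathbb{Z}_{>0}$; a cell $(r,c)$ lies in row $r$ (rows numbered from the bottom, starting at $1$) and column $c$. Applying a Kohnert move at row $r$ of a diagram $D$: if row $r$ is nonempty, let $(r,c)$ be its rightmost cell; if there is $r'$ with $1\le r'<r$ and $(r',c)\notin D$, take the largest such $r'$ and replace $(r,c)$ by $(r',c)$; otherwise $D$ is unchanged. $KD(D)$ is the set of diagrams obtainable from $D$ by finite (possibly empty) sequences of Kohnert moves; the Kohnert poset $\mathcal{P}(D)$ is $KD(D)$ with $D_2\preceq D_1$ iff $D_2$ can be obtained from $D_1$ by a sequence of Kohnert moves. For a diagram $T$, $wt(T)=\prod_{i\ge1}x_i^{(\text{number of cells in row } i \text{ of } T)}$, and $\mathfrak{K}_D=\sum_{T\in KD(D)}wt(T)$. It is multiplicity free if every monomial has coefficient $0$ or $1$. The order complex of a finite poset is the simplicial complex of its chains. A simplicial complex is shellable if its facets can be ordered $F_1,\dots,F_t$ so that for each $2\le k\le t$ the complex $\left(\bigcup_{i<k}\overline{F_i}\right)\cap\overline{F_k}$ is pure of dimension $\dim F_k-1$ ($\overline F$ = all subsets of $F$, $\dim F=|F|-1$). A poset is shellable if its order complex is. A bounded poset (unique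 minimum and maximum) is EL-shellable if its covering pairs admit a labeling $\lambda$ by elements of some poset such that every interval $[x,y]$ has a unique saturated chain from $x$ to $y$ with weakly increasing labels, and its label sequence is lexicographically smaller than that of every other saturated chain from $x$ to $y$. *)

(* Defs.v *)
From HB Require Import structures.
From mathcomp Require Import all_boot all_order all_algebra.
From mathcomp Require Import finmap boolp.
From mathcomp.multinomials Require Import monalg.

Set Implicit Arguments.
Unset Strict Implicit.
Unset Printing Implicit Defensive.

Import Order.TTheory GRing.Theory.

Local Open Scope fset_scope.

(* The cell (r, c) lies in row r and column c. *)
Notation cell := (nat * nat)%type.
Notation cells := {fset cell}.

Definition is_diagram (D : cells) : Prop :=
  forall x : cell, x \in D -> (0 < x.1)%N /\ (0 < x.2)%N.

Definition row_cols (D : cells) (r : nat) : {fset nat} :=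
  [fset x.2 | x in D & x.1 == r].

Definition free_below (D : cells) (r c : nat) : {fset nat} :=
  [fset q in iota 1 r.-1 | (q, c) \notin D].

Definition kohnert_move (D : cells) (r : nat) : cells :=
  if row_cols D r == fset0 then D else
  let c := \max_(j <- row_cols D r) j in
  if free_below D r c == fset0 then D else
  let q := \max_(i <- free_below D r c) i in
  (q, c) |` (D `\ (r, c)).

Definition kohnert_reach (D T : cells) : Prop :=
  exists rs : seq nat, T = foldl kohnert_move D rs.

(* Moves only lower cells within their columns, so every diagram reachable
   from D is a subset of this finite set; see [KDP]. *)
Definition shadow (D : cells) : cells :=
  [fset ((i, x.2) : cell) | x in D, i in iota 0 x.1.+1].

Definition KD (D : cells) : {fset cells} :=
  [fset T in fpowerset (shadow D) | `[< kohnert_reach D T >]].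

Lemma bigmax_mem (A : {fset nat}) : A != fset0 -> \max_(i <- A) i \in A.
Proof.
case/fset0Pn=> a aA; suff: forall s : seq nat, s != [::] -> \max_(i <- s) i \in s.
  by apply; apply: contraTneq aA => A0; rewrite -[a \in A]/(a \in enum_fset A) A0.
elim=> // x [|y s] IH _; first by rewrite big_seq1 mem_head.
rewrite big_cons /maxn; case: ifP => _; last exact: mem_head.
by rewrite inE IH ?orbT.
Qed.

Variant kohnert_move_spec (D : cells) (r : nat) : cells -> Prop :=
| KohnertMoveId : kohnert_move_spec D r D
| KohnertMoveLower q c of (r, c) \in D & (q, c) \notin D & (0 < q < r)%N :
    kohnert_move_spec D r ((q, c) |` (D `\ (r, c))).

Lemma kohnert_moveP D r : kohnert_move_spec D r (kohnert_move D r).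
Proof.
rewrite /kohnert_move; case: eqP => [_|/eqP C0]; first exact: KohnertMoveId.
case: eqP => [_|/eqP E0] /=; first exact: KohnertMoveId.
have /imfsetP[[x1 x2] /=] := bigmax_mem C0; rewrite inE /= => /andP[xD /eqP xr] cE.
have := bigmax_mem E0; rewrite !inE /= mem_iota => /andP[qr qD].
apply: KohnertMoveLower => //; first by rewrite cE -xr.
by case: r qr {xr C0 E0 cE qD} => [|r]; rewrite ?add1n // => /andP[q0 qr]; case: ltngtP qr q0.
Qed.

Lemma kohnert_reach_refl D : kohnert_reach D D.
Proof. by exists [::]. Qed.

Lemma kohnert_reach_trans D T U :
  kohnert_reach D T -> kohnert_reach T U -> kohnert_reach D U.
Proof. by move=> [rs ->] [ss ->]; exists (rs ++ ss); rewrite foldl_cat. Qed.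

Lemma in_shadow D i j :
  reflect (exists2 x, x \in D & (i <= x.1)%N /\ j = x.2) ((i, j) \in shadow D).
Proof.
apply: (iffP idP) => [/imfset2P/=[x xD [k]]|[x xD [ix ->]]]; last apply/imfset2P.
  rewrite -[in_mem k _]/(k \in iota 0 x.1.+1) mem_iota => kx [-> ->].
  by exists x.
by exists x => //; exists i => //; rewrite -[in_mem i _]/(i \in iota 0 x.1.+1) mem_iota.
Qed.

Lemma kohnert_reach_shadow D T : kohnert_reach D T -> T `<=` shadow D.
Proof.
case=> rs ->; have: D `<=` shadow D.
  by apply/fsubsetP=> -[i j] xD; apply/in_shadow; exists (i, j).
elim: rs {1 3}D => //= r rs IH U UD; apply: IH.
case: kohnert_moveP => // q c rcU _ /andP[_ qr].
apply/fsubsetP=> x; rewrite !inE => /orP[/eqP->|/andP[_ /(fsubsetP UD)//]].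
have /in_shadow[y yD [ry cy]] := fsubsetP UD _ rcU.
by apply/in_shadow; exists y => //; split=> //; apply: leq_trans ry; apply: ltnW.
Qed.

Lemma KDP D T : reflect (kohnert_reach D T) (T \in KD D).
Proof.
rewrite !inE /= fpowersetE; apply: (iffP andP) => [[_ /asboolP//]|DT].
by split; [apply: kohnert_reach_shadow | apply/asboolP].
Qed.

Lemma kohnert_reach_anti D T :
  kohnert_reach D T -> kohnert_reach T D -> D = T.
Proof.
pose mu (U : cells) := \sum_(x <- U) x.1.
have step U r : kohnert_move U r = U \/ (mu (kohnert_move U r) < mu U)%N.
  case: kohnert_moveP => [|q c rcU qcU /andP[_ qr]]; [by left | right].
  rewrite /mu (big_fsetD1 _ rcU) /= big_fsetU1 ?ltn_add2r //=.
  by rewrite !inE (negPf qcU) andbF.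
have lt U V : kohnert_reach U V -> V = U \/ (mu V < mu U)%N.
  case=> rs ->; elim: rs U => [|r rs IH] U /=; first by left.
  case: (IH (kohnert_move U r)) => [->|H]; first exact: step.
  by right; case: (step U r) => [E|]; [rewrite E in H * | apply: ltn_trans].
move=> /lt[->//|TD] /lt[//|DT].
by have := ltn_trans TD DT; rewrite ltnn.
Qed.

Definition kohnert_poset (D : cells) : Type := KD D.

HB.instance Definition _ D := Finite.on (kohnert_poset D).

Definition kohnert_le D (x y : kohnert_poset D) : bool :=
  `[< kohnert_reach (val y) (val x) >].

Lemma kohnert_le_refl D : reflexive (@kohnert_le D).
Proof. by move=> x; apply/asboolP/kohnert_reach_refl. Qed.

Lemma kohnert_le_anti D : antisymmetric (@kohnert_le D).
Proof.
move=> x y /andP[/asboolP yx /asboolP xy].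
by apply: val_inj; apply: kohnert_reach_anti.
Qed.

Lemma kohnert_le_trans D : transitive (@kohnert_le D).
Proof.
move=> y x z /asboolP yx /asboolP zy.
by apply/asboolP; apply: kohnert_reach_trans zy yx.
Qed.

Fact kohnert_display : Order.disp_t. Proof. exact: Order.Disp tt tt. Qed.

HB.instance Definition _ D :=
  Order.Le_isPOrder.Build kohnert_display (kohnert_poset D)
    (@kohnert_le_refl D) (@kohnert_le_anti D) (@kohnert_le_trans D).

(* Polynomials in the variables x_i (i : nat) with integer coefficients are the
   monoid algebra of the free commutative monoid on nat; x_0 never occurs for
   diagrams. *)
Definition wt (T : cells) : {cmonom nat} :=
  [cmonom #|` [fset x in T | x.1 == i]| | i in [fset x.1 | x in T]]%M.

Definition kohnert_poly (D : cells) : {malg int[{cmonom nat}]} :=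
  (\sum_(T <- KD D) << wt T >>)%R.

Definition multiplicity_free (p : {malg int[{cmonom nat}]}) : Prop :=
  forall m : {cmonom nat}, (p@_m = 0 \/ p@_m = 1)%R.

(* A simplicial complex on V is the set of its faces, the empty face included. *)
Section SimplicialComplex.
Variable V : finType.
Implicit Types (K : {set {set V}}) (F : {set V}).

Definition facets K : {set {set V}} := [set F | maxset (mem K) F].

Definition dim F : int := (#|F|%:Z - 1)%R.

Definition pure_of_dim K (d : int) : Prop :=
  K != set0 /\ forall F, F \in facets K -> dim F = d.

Definition shelling K (Fs : seq {set V}) : Prop :=
  [/\ uniq Fs, Fs =i facets K &
      forall k, (0 < k < size Fs)%N ->
        pure_of_dim
          ((\bigcup_(i < k) powerset (nth set0 Fs i))
             :&: powerset (nth set0 Fs k))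
          (dim (nth set0 Fs k) - 1)%R].

Definition shellable_complex K : Prop := exists Fs, shelling K Fs.

End SimplicialComplex.

Section Poset.
Variables (disp : Order.disp_t) (P : finPOrderType disp).
Implicit Types (x y z : P) (s t : seq P).
Local Open Scope order_scope.

Definition order_complex : {set {set P}} :=
  [set C : {set P} | [forall x in C, forall y in C, x >=< y]].

Definition shellable : Prop := shellable_complex order_complex.

Definition bounded : Prop :=
  (exists b, forall x, b <= x) /\ (exists z, forall x, x <= z).

Definition covered x y : bool := (x < y) && [forall z, ~~ (x < z < y)].

(* The chain is x :: s. *)
Definition saturated_chain x y s : bool := path covered x s && (last x s == y).

Definition labels (L : Type) (lam : P -> P -> L) x s : seq L := pairmap lam x s.

(* Only the values of lam on covering pairs are used. *)
Definition EL_labeling (d : Order.disp_t) (L : porderType d)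
    (lam : P -> P -> L) : Prop :=
  forall x y, x <= y ->
    exists s,
      [/\ saturated_chain x y s,
          sorted <=%O (labels lam x s),
          forall t, saturated_chain x y t -> sorted <=%O (labels lam x t) ->
            t = s
        & forall t, saturated_chain x y t -> t <> s ->
            (labels lam x s : seqlexi L) < (labels lam x t : seqlexi L)].

Definition EL_shellable : Prop :=
  bounded /\
  exists (d : Order.disp_t) (L : porderType d) (lam : P -> P -> L),
    EL_labeling lam.

End Poset.

Arguments shellable {disp} P.
Arguments EL_shellable {disp} P.

(* Main.v *)
Require Import Defs.
From HB Require Import structures.
From mathcomp Require Import all_boot all_order all_algebra.
From mathcomp Require Import finmap boolp zify.
From mathcomp.multinomials Require Import monalg.

Set Implicit Arguments.
Unset Strict Implicit.
Unset Printing Implicit Defensive.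

Import Order.TTheory.

(* Read the cells of D in rows at least 2 column by column from left to right, each column from top to bottom. If the rows never increase along this reading and only the last column has several cells, then a diagram of KD(D) is determined by its weakly decreasing vector of rows: weights are then injective on KD(D), and the Kohnert order is the componentwise order on an interval of a Young-type lattice, for which the coordinate raised by a cover is an EL-labeling. Lexicographic order on maximal chains gives the shelling.
   Otherwise, D reaches a diagram T with a cell (p+1, c) and, further right, a cell (p+2, c') that can each be lowered to row p while the other cells stay put. When (p+1, c') is occupied it blocks (p+1, c), so the interval below T is a hexagon: two chains of length 3 with nothing between them. This forbids shellings and EL-labelings, and the diagrams with the two cells in rows (p, p+1) and (p+1, p) have the same weight. The room to reach T is exactly what the two alternative hypotheses on D provide. *)

(** * Shellings and EL-labelings *)

(** The amount of room is dictated by the rows p, p+1, p+2 of the hexagon. For an increasing pair,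
    the cells read after the one in column c' lie in rows at most p+1, and to the right of c' only
    rows p+1 and p+2 have to be clear: lowering by one row is enough. Another cell of column c'
    itself must also avoid row p, which takes two rows; hence the two alternatives, with single-cell
    columns in one and two empty rows in the other. When the rows decrease but a column with several
    cells is not the last one, there is no increasing pair to start from and one has to be created
    by a jump inside that column. Little is known about the poset outside the hexagonal interval, so
    the obstruction is proved for arbitrary finite posets and for shellings that need not be
    pure. *)

Section Shelling.
Variable V : finType.
Implicit Types (K : {set {set V}}) (F : {set V}) (Fs : seq {set V}).

Lemma facetsP K F :
  reflect (F \in K /\ forall G : {set V}, G \in K -> F \subset G -> G = F)
          (F \in facets K).
Proof. by rewrite inE; apply: maxsetP. Qed.

Lemma dim_predE (F G : {set V}) : (Defs.dim F = Defs.dim G - 1)%R <-> #|F|.+1 = #|G|.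
Proof. by rewrite /Defs.dim; lia. Qed.

Let inter Fs k : {set {set V}} :=
  (\bigcup_(i < k) powerset (nth set0 Fs i)) :&: powerset (nth set0 Fs k).

Let interP Fs k F :
  reflect (exists i, [/\ i < k, F \subset nth set0 Fs i & F \subset nth set0 Fs k])
          (F \in inter Fs k).
Proof.
apply: (iffP idP) => [|[i [ik Fi Fk]]]; rewrite inE powersetE.
  by case/andP=> /bigcupP[[i ik] _]; rewrite powersetE => Fi Fk; exists i.
by rewrite Fk andbT; apply/bigcupP; exists (Ordinal ik); rewrite ?powersetE.
Qed.

(** The exchange form of a shelling. By purity, a facet of the intersection that contains the common
    part of the [i]-th and [k]-th facets misses exactly one vertex [z] of the [k]-th. Conversely,
    exchange puts every face of the intersection inside one that misses a single vertex. *)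
Lemma shellingP K Fs :
  shelling K Fs <->
  [/\ uniq Fs, Fs =i facets K &
      forall i k, i < k < size Fs -> exists j z,
        [/\ j < k, z \in nth set0 Fs k, z \notin nth set0 Fs i
          & nth set0 Fs k :\ z \subset nth set0 Fs j]].
Proof.
split=> -[Fs_uniq FsK H]; split=> //.
  move=> i k /andP[ik ks]; have k_gt0: 0 < k < size Fs by lia.
  have [_ pureF] := H k k_gt0.
  have sI: nth set0 Fs i :&: nth set0 Fs k \in inter Fs k.
    by apply/interP; exists i; rewrite subsetIl subsetIr.
  have [G maxG sG] := maxset_exists (P := mem (inter Fs k)) sI.
  have /pureF/dim_predE cG : G \in facets (inter Fs k) by rewrite inE.
  have /interP[j [jk Gj Gk]] := maxsetp maxG.
  have /eqP/cards1P[z DG] : #|nth set0 Fs k :\: G| = 1.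
    by rewrite cardsD (setIidPr Gk) -cG; lia.
  have: z \in nth set0 Fs k :\: G by rewrite DG inE.
  rewrite inE => /andP[zG zk]; exists j, z; split=> //.
    by apply: contra zG => zi; apply: (subsetP sG); rewrite inE zi.
  apply: subset_trans Gj; apply/subsetP=> x; rewrite !inE => /andP[xz xk].
  by apply: contraNT xz => xG; rewrite -in_set1 -DG inE xG.
move=> k /andP[k0 ks]; split.
  by apply/set0Pn; exists set0; apply/interP; exists 0; rewrite !sub0set.
move=> F /facetsP[/interP[i [ik Fi Fk]] maxF]; apply/dim_predE.
have [j [z [jk zk zi sj]]] : exists j z,
    [/\ j < k, z \in nth set0 Fs k, z \notin nth set0 Fs i
      & nth set0 Fs k :\ z \subset nth set0 Fs j] by apply: H; rewrite ik.
rewrite -(maxF (nth set0 Fs k :\ z)).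
- by rewrite (cardsD1 z (nth set0 Fs k)) zk.
- by apply/interP; exists j; rewrite subD1set.
apply/subsetP=> x xF; rewrite !inE (subsetP Fk) // andbT.
by apply: contraNneq zi => <-; apply: (subsetP Fi).
Qed.

End Shelling.

(** * Chains, covers and the facets of the order complex; the hexagon obstruction *)

Section OrderComplex.
Variables (disp : Order.disp_t) (P : finPOrderType disp).
Implicit Types (x y z t : P) (s r : seq P).
Local Open Scope order_scope.

Lemma order_complexP (C : {set P}) :
  reflect {in C &, forall x y, x >=< y} (C \in order_complex P).
Proof.
rewrite inE; apply: (iffP forall_inP) => [H x y xC yC|H x xC].
  by have /forall_inP := H x xC; apply.
by apply/forall_inP => y; apply: H.
Qed.

Lemma coveredP x y : reflect (x < y /\ forall z, x < z -> z <= y -> z = y) (covered x y).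
Proof.
apply: (iffP andP) => [[xy /forallP H]|[xy H]]; split=> //.
  move=> z xz; rewrite le_eqVlt => /predU1P[//|zy].
  by have := H z; rewrite xz zy.
apply/forallP=> z; apply/negP=> /andP[xz zy].
by move: (zy); rewrite (H z xz (ltW zy)) ltxx.
Qed.

Lemma covered_lt x y : covered x y -> x < y.
Proof. by case/andP. Qed.

Lemma covered_path_lt x s : path (@covered _ P) x s -> path <%O x s.
Proof. by apply: sub_path => ? ?; apply: covered_lt. Qed.

Lemma covered_path_last x s : path (@covered _ P) x s -> x <= last x s.
Proof.
elim: s x => //= y s IH x /andP[/covered_lt xy /IH]; exact: le_trans (ltW xy).
Qed.

Lemma covered_path_gt x s y : path (@covered _ P) x s -> y \in s -> x < y.
Proof. by move=> /covered_path_lt /(order_path_min lt_trans)/allP; apply. Qed.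

Lemma saturated_chain_cat x y z s r :
  saturated_chain x y s -> saturated_chain y z r -> saturated_chain x z (s ++ r).
Proof.
case/andP=> sp /eqP sl /andP[rp rl].
by rewrite /saturated_chain cat_path last_cat sp sl rp.
Qed.

Lemma saturated_chain_nil x s : saturated_chain x x s -> s = [::].
Proof.
case: s => // y s /andP[p /eqP e].
by have := covered_path_gt p (mem_last y s); rewrite -e /= ltxx.
Qed.

(** An element comparable with the whole chain falls between two consecutive members, where the
    cover leaves no room; the hypothesis on [x] and [y] prevents it from lying beyond the ends. *)
Lemma saturated_chain_facet x y s :
  (forall z, x <= z <= y) -> saturated_chain x y s ->
  [set z in x :: s] \in facets (order_complex P).
Proof.
move=> bd /andP[p /eqP e]; apply/facetsP; split.
  have srt : sorted <=%O (x :: s).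
    by apply: sub_sorted (covered_path_lt p : sorted <%O (x :: s)) => ? ?; apply: ltW.
  apply/order_complexP => u v; rewrite !in_set => us vs.
  have := srt; rewrite sorted_pairwise; last exact: le_trans.
  elim: {p e srt}(x :: s) us vs => //= w r IH; rewrite !inE => us vs /andP[wr /IH{}IH].
  case/predU1P: us => [->|us]; case/predU1P: vs => [->|vs] //.
  - by rewrite comparablexx.
  - by rewrite /Order.comparable (allP wr).
  - by rewrite /Order.comparable (allP wr) ?orbT.
  - exact: IH.
move=> G /order_complexP Gch sG; apply/eqP; rewrite eqEsubset sG andbT.
apply/subsetP=> z zG; rewrite inE.
have {}Gch w : w \in s -> w >=< z by move=> ws; apply: Gch => //; apply: (subsetP sG); rewrite !inE ws orbT.
have /andP[xz zy] := bd z.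
rewrite -e in zy; elim: s x p {e sG bd} xz zy Gch => [|w s IH] x /=.
  by move=> _ xz zx _; rewrite inE eq_le xz zx.
case/andP=> /coveredP[xw cov] p xz zl cmp.
have := cmp w; rewrite inE eqxx => /(_ isT); rewrite /Order.comparable => /orP[wz|zw].
  by rewrite inE IH ?orbT // => v vs; apply: cmp; rewrite inE vs orbT.
move: xz; rewrite le_eqVlt => /predU1P[->|xz]; first by rewrite inE eqxx.
by rewrite (cov z xz zw) !inE eqxx orbT.
Qed.

(* The open interval (b, t) then has rank 3 and is disconnected, which neither a shelling nor an EL-labeling allows. *)
Definition hexagon (b u2 u1 v2 v1 t : P) : Prop :=
  [/\ [/\ b < u2, u2 < u1 & u1 < t], [/\ b < v2, v2 < v1 & v1 < t],
      forall x, b <= x <= t -> x \in [:: b; u2; u1; v2; v1; t]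
    & forall x y, x \in [:: u1; u2] -> y \in [:: v1; v2] -> ~~ (x >=< y)].

Lemma hexagon_sym b u2 u1 v2 v1 t : hexagon b u2 u1 v2 v1 t -> hexagon b v2 v1 u2 u1 t.
Proof.
case=> H1 H2 H3 H4; split=> // [x /H3|x y xv yu].
  by rewrite !inE => /or4P[|||/or3P[]] ->; rewrite ?orbT.
by rewrite comparable_sym H4.
Qed.

Section Hexagon.
Variables b u2 u1 v2 v1 t : P.
Hypothesis hex : hexagon b u2 u1 v2 v1 t.

Let hexU x : b < x -> x <= u1 -> x = u2 \/ x = u1.
Proof.
case: hex => -[b2 u21 u1t] _ cov inc bx xu.
have: b <= x <= t by rewrite ltW //= (le_trans xu) ?ltW.
move=> /cov; rewrite !inE; case/or4P=> [/eqP xb|/eqP|/eqP|]; try by auto.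
  by rewrite xb ltxx in bx.
case/or3P=> /eqP xv.
- by have := inc u1 v2; rewrite -xv /Order.comparable xu orbT !inE !eqxx ?orbT => /(_ isT isT).
- by have := inc u1 v1; rewrite -xv /Order.comparable xu orbT !inE !eqxx ?orbT => /(_ isT isT).
by move: u1t; rewrite -xv => /lt_geF; rewrite xu.
Qed.

Let hexT x : u2 < x -> x <= t -> x = u1 \/ x = t.
Proof.
case: hex => -[b2 u21 u1t] _ cov inc ux xt.
have: b <= x <= t by rewrite xt ltW // (lt_trans b2).
move=> /cov; rewrite !inE; case/or4P=> [/eqP xb|/eqP xu|/eqP|]; try by auto.
- by move: ux; rewrite xb => /lt_gtF; rewrite b2.
- by rewrite xu ltxx in ux.
case/or3P=> /eqP xv; last by right.
- by have := inc u2 v2; rewrite -xv /Order.comparable (ltW ux) !inE !eqxx ?orbT => /(_ isT isT).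
- by have := inc u2 v1; rewrite -xv /Order.comparable (ltW ux) !inE !eqxx ?orbT => /(_ isT isT).
Qed.

Let bu2 : b < u2. Proof. by case: hex => -[]. Qed.
Let u21 : u2 < u1. Proof. by case: hex => -[]. Qed.
Let u1t : u1 < t. Proof. by case: hex => -[]. Qed.

Let cov_b : covered b u2.
Proof.
apply/coveredP; split=> // z bz zu; case: (hexU bz (le_trans zu (ltW u21))) => // zu1.
by move: u21; rewrite -zu1 => /lt_geF; rewrite zu.
Qed.
Let cov_2 : covered u2 u1.
Proof. by apply/coveredP; split=> // z uz zu; case: (hexU (lt_trans bu2 uz) zu) => // zu2; rewrite zu2 ltxx in uz. Qed.
Let cov_1 : covered u1 t.
Proof. by apply/coveredP; split=> // z uz zt; case: (hexT (lt_trans u21 uz) zt) => // zu1; rewrite zu1 ltxx in uz. Qed.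

Lemma hexagon_saturated_chain : saturated_chain b t [:: u2; u1; t].
Proof. by rewrite /saturated_chain /= cov_b cov_2 cov_1 eqxx. Qed.

(* Both two-step subintervals consist of a single saturated chain, which must be increasing. *)
Lemma hexagon_increasing (d : Order.disp_t) (L : porderType d) (lam : P -> P -> L) :
  EL_labeling lam -> sorted <=%O (labels lam b [:: u2; u1; t]).
Proof.
move=> EL; have tl x y z s : covered x y -> covered y z ->
    (forall w, x < w -> w <= z -> w = y \/ w = z) ->
    saturated_chain x z s -> s = [:: y; z].
  move=> xy yz only /andP[]; case: s => [|w s] /=.
    by move=> _ /eqP xz; move: (covered_lt xy); rewrite xz => /lt_gtF; rewrite covered_lt.
  case/andP=> xw ws /eqP sl.
  have [wy|wz] := only w (covered_lt xw) (ltac:(rewrite -sl; exact: covered_path_last ws)).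
    rewrite wy in ws sl *; case: s ws sl => [|v s] /=.
      by move=> _ ez; move: (covered_lt yz); rewrite ez ltxx.
    case/andP=> yv vs sl.
    have vz : v = z.
      have [_ cz] := coveredP _ _ yz; apply: cz; first exact: covered_lt.
      by rewrite -sl; exact: covered_path_last vs.
    by rewrite vz in vs sl *; rewrite (@saturated_chain_nil z s) // /saturated_chain vs sl eqxx.
  have [_ cz] := coveredP _ _ xw.
  have wy: y = w by apply: cz; [exact: covered_lt xy | rewrite wz ltW // covered_lt].
  by move: (covered_lt yz); rewrite wy wz ltxx.
have [s [ss so _ _]] := EL b u1 (ltW (lt_trans bu2 u21)).
have [r [rs ro _ _]] := EL u2 t (ltW (lt_trans u21 u1t)).
rewrite (tl _ _ _ _ cov_b cov_2 hexU ss) /= andbT in so.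
rewrite (tl _ _ _ _ cov_2 cov_1 hexT rs) /= andbT in ro.
by rewrite /= so ro.
Qed.

End Hexagon.

Lemma hexagon_not_EL_shellable b u2 u1 v2 v1 t :
  hexagon b u2 u1 v2 v1 t -> ~ EL_shellable P.
Proof.
move=> hex [_ [d [L [lam EL]]]]; have hex' := hexagon_sym hex.
have bt : b <= t by case: hex => -[bu u21 ut] _ _ _; rewrite ltW // (lt_trans bu) // (lt_trans u21).
have [s [_ _ uniq_s _]] := EL b t bt.
have es := uniq_s _ (hexagon_saturated_chain hex) (hexagon_increasing hex EL).
have := uniq_s _ (hexagon_saturated_chain hex') (hexagon_increasing hex' EL).
rewrite -es => -[e _]; case: hex => _ _ _ /(_ u2 v2).
by rewrite e !inE eqxx !orbT comparablexx => /(_ isT isT).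
Qed.

(** Extend the [u] chain to a maximal chain [C] and let [D] be the result of exchanging [u1], [u2]
    for [v1], [v2]. The common part [S] lies in no other facet, so its link consists of two disjoint
    edges. Whichever of [C] and [D] comes later in a shelling would have to share all but one of its
    vertices with the earlier one, but it differs from it in two. *)
Lemma hexagon_not_shellable b u2 u1 v2 v1 t :
  hexagon b u2 u1 v2 v1 t -> ~ shellable P.
Proof.
move=> hex [Fs /shellingP[Funiq FsK exch]].
have [[bu u21 ut] [bv v21 vt] cov inc] := hex.
have inc' x y : x \in [:: u1; u2] -> y \in [:: v1; v2] -> y >=< x -> False.
  by move=> xu yv; rewrite comparable_sym; apply/negP/inc.
have chU : [set b; u2; u1; t] \in order_complex P.
  have bu1 := lt_trans bu u21; have u2t := lt_trans u21 ut; have bt := lt_trans bu u2t.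
  apply/order_complexP => x y; rewrite !inE -!orbA /Order.comparable.
  by case/or4P=> /eqP-> /or4P[] /eqP->; rewrite ?lexx // ?(ltW bu, ltW u21, ltW ut, ltW bu1, ltW u2t, ltW bt) ?orbT.
have [C maxC /subsetP sC] := maxset_exists chU.
have Cfacet : C \in facets (order_complex P) by rewrite inE.
have /facetsP[/order_complexP Cch Cmax] := Cfacet.
have memC x : (forall y, y \in C -> x >=< y) -> x \in C.
  move=> xC; suff <- : x |: C = C by rewrite setU11.
  apply: Cmax (subsetU1 _ _); apply/order_complexP => p q.
  rewrite !inE => /predU1P[->|pC] /predU1P[->|qC]; rewrite ?comparablexx //.
  - exact: xC.
  - by rewrite comparable_sym xC.
  - exact: Cch.
have [bC u2C u1C tC] : [/\ b \in C, u2 \in C, u1 \in C & t \in C].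
  by split; apply: sC; rewrite !inE eqxx ?orbT.
pose S := C :\ u1 :\ u2.
have inS y : y \in C -> y \in S \/ y \in [:: u1; u2].
  by rewrite !inE => ->; case: eqP => _; case: eqP => _; rewrite ?orbT; auto.
have bS : b \in S by rewrite !inE bC (lt_eqF bu) (lt_eqF (lt_trans bu u21)).
have tS : t \in S by rewrite !inE tC (gt_eqF ut) (gt_eqF (lt_trans u21 ut)).
have SC y : y \in S -> y \in C by rewrite !inE => /and3P[].
have out x : x >=< b -> x >=< t -> [\/ x <= b, t <= x | x \in [:: u1; u2; v1; v2]].
  move=> /orP[xb|bx]; first by constructor 1.
  move=> /orP[xt|tx]; last by constructor 2.
  have := cov x; rewrite bx xt => /(_ isT); rewrite !inE => /or4P[|||/or3P[]] /eqP->;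
    by [constructor 1 | constructor 2 | constructor 3; rewrite eqxx ?orbT].
have Sbt y : y \in S -> y <= b \/ t <= y.
  move=> yS; case: (out y); rewrite ?Cch ?SC //; try by auto.
  move: (yS); rewrite !inE => /and3P[/negPf-> /negPf-> yC] /= yv.
  by case: (inc' u1 y); rewrite ?inE ?eqxx ?yv // Cch.
(* An element below [b] or above [t] is comparable with [u1] and [u2] through that end, so the
   maximality of [C] puts it in [C]. *)
have extS x : (forall y, y \in S -> x >=< y) -> x \in S \/ x \in [:: u1; u2; v1; v2].
  move=> xS.
  have uu y : y \in [:: u1; u2] -> b < y < t.
    by rewrite !inE => /orP[] /eqP->; rewrite ?ut ?bu (lt_trans bu, lt_trans u21).
  case: (out x) => //; rewrite ?xS //; try by auto.
    move=> xb; left; have /inS[//|/uu] : x \in C; last by rewrite (le_gtF xb).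
    apply: memC => y /inS[/xS//|/uu/andP[/ltW byy _]].
    by rewrite /Order.comparable (le_trans xb byy).
  move=> tx; left; have /inS[//|/uu] : x \in C; last by rewrite (le_gtF tx) andbF.
  apply: memC => y /inS[/xS//|/uu/andP[_ /ltW yt]].
  by rewrite /Order.comparable (le_trans yt tx) orbT.
pose D := v1 |: (v2 |: S).
have vbt y : y \in [:: v1; v2] -> b <= y <= t.
  by rewrite !inE => /orP[] /eqP->; rewrite ?(ltW vt, ltW bv, ltW (lt_trans bv v21), ltW (lt_trans v21 vt)).
have Dch : D \in order_complex P.
  have vS x y : x \in [:: v1; v2] -> y \in S -> x >=< y.
    move=> /vbt/andP[bx xt] /Sbt[yb|ty]; rewrite /Order.comparable.
      by rewrite (le_trans yb) ?orbT.
    by rewrite (le_trans xt).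
  have vv x y : x \in [:: v1; v2] -> y \in [:: v1; v2] -> x >=< y.
    rewrite !inE /Order.comparable => /orP[] /eqP-> /orP[] /eqP->;
    by rewrite ?lexx // (ltW v21) ?orbT.
  have inD x : x \in D -> x \in [:: v1; v2] \/ x \in S.
    by rewrite !inE => /or3P[->|->|/and3P[-> -> ->]]; rewrite ?orbT; auto.
  apply/order_complexP => x y /inD[xv|xS] /inD[yv|yS].
  - exact: vv.
  - exact: vS.
  - by rewrite comparable_sym vS.
  - by rewrite Cch ?SC.
have SD : S \subset D by rewrite /D; apply/subsetP=> x xS; rewrite !in_setU1 xS !orbT.
have two F : F \in facets (order_complex P) -> S \subset F -> F = C \/ F = D.
  move=> /facetsP[/order_complexP Fch Fmax] /subsetP SF.
  have FS x : x \in F -> x \in S \/ x \in [:: u1; u2; v1; v2].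
    by move=> xF; apply: extS => y /SF; apply: Fch.
  have [/existsP[w /andP[wF wu]]|/existsPn noU] := boolP [exists w, (w \in F) && (w \in [:: u1; u2])].
    left; rewrite (Fmax C) //; first exact/order_complexP.
    apply/subsetP=> x xF; case: (FS x xF) => [/SC//|].
    rewrite !inE => /or4P[/eqP->|/eqP->|xv|xv] //; by case: (inc' w x wu); rewrite ?inE ?xv ?orbT ?Fch.
  right; rewrite -(Fmax D) //; apply/subsetP=> x xF; rewrite /D !in_setU1.
  case: (FS x xF) => [->|]; rewrite ?orbT // !inE.
  by have := noU x; rewrite xF !inE negb_or => /andP[/negPf-> /negPf->] /= /orP[] ->; rewrite ?orbT.
have vC y : y \in [:: v1; v2] -> y \notin C.
  by move=> yv; apply/negP=> yC; apply: (inc' u1 y) => //; rewrite ?inE ?eqxx // Cch.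
have vD y : y \in [:: v1; v2] -> y \in D.
  by rewrite !inE => /orP[]->; rewrite ?orbT.
have uD y : y \in [:: u1; u2] -> y \notin D.
  move=> yu; apply/negP=> yD; have /order_complexP Dc := Dch.
  by apply: (inc' y v1 yu); rewrite ?mem_head // Dc // vD ?mem_head.
have Dfacet : D \in facets (order_complex P).
  have [G maxG DG] := maxset_exists Dch.
  have Gf : G \in facets (order_complex P) by rewrite inE.
  have [GC|GD] := two G Gf (subset_trans SD DG); last by rewrite -GD.
  by have := vC v1; rewrite -GC (subsetP DG) ?vD ?inE ?eqxx // => /(_ isT).
(* Stated for an abstract pair, to serve both orders of [C] and [D]. The exchanged vertex [z] is
   outside [S], so the facet [j] contains [S] and must be [F], as [j < k]; then [z] is the only
   element of [G] outside [F]. *)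
have clash i k F G : (i < k < size Fs)%N -> nth set0 Fs i = F -> nth set0 Fs k = G ->
    (forall H, H \in facets (order_complex P) -> S \subset H -> H = F \/ H = G) ->
    S \subset F -> S \subset G ->
    (exists p q, [/\ p != q, p \in G, q \in G, p \notin F & q \notin F]) -> False.
  move=> /andP[ik ks] Fi Gk only SF SG [p [q [pq pG qG pF qF]]].
  have [j [z [jk zk zi sj]]] : exists j z, [/\ (j < k)%N, z \in nth set0 Fs k,
      z \notin nth set0 Fs i & nth set0 Fs k :\ z \subset nth set0 Fs j].
    by apply: exch; apply/andP; split.
  rewrite Fi Gk in zk zi sj.
  have js : (j < size Fs)%N by apply: ltn_trans ks.
  have Sj : S \subset nth set0 Fs j.
    apply: subset_trans sj; rewrite subsetD1 SG.
    by apply: contra zi; apply: (subsetP SF).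
  have Fj : nth set0 Fs j \in facets (order_complex P) by rewrite -FsK mem_nth.
  have [jF|/eqP] := only _ Fj Sj; last first.
    by rewrite -Gk nth_uniq // ltn_eqF.
  have sub w : w \in G -> w \notin F -> w = z.
    move=> wG wF; apply/eqP; apply: contraNT wF => wz.
    by rewrite -jF (subsetP sj) // !inE wz.
  by case/eqP: pq; rewrite (sub p) // (sub q).
have := Cfacet; rewrite -FsK => /(nthP set0)[iC iCs eC].
have := Dfacet; rewrite -FsK => /(nthP set0)[iD iDs eD].
have [lt|lt|eqi] := ltngtP iC iD.
- apply: (@clash iC iD C D) => //; first by apply/andP.
    by apply/subsetP.
  by exists v1, v2; rewrite (gt_eqF v21) !vD ?vC ?inE ?eqxx ?orbT.
- apply: (@clash iD iC D C) => //; first by apply/andP.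
  + by move=> H Hf SH; case: (two H Hf SH); auto.
  + by apply/subsetP.
  by exists u1, u2; rewrite (gt_eqF u21) u1C u2C !uD ?inE ?eqxx ?orbT.
by have := vC v1; rewrite -eC eqi eD vD ?inE ?eqxx // => /(_ isT).
Qed.
End OrderComplex.

(** With equal lengths [s] cannot be a proper prefix of [t], so the comparison is decided before the
    tails [q] and [r] are reached. *)
Lemma lt_seqlexi_cat (d : Order.disp_t) (L : porderType d) (p s t q r : seq L) :
  size s = size t -> ((s : seqlexi L) < (t : seqlexi L))%O ->
  ((p ++ s ++ q : seqlexi L) < (p ++ t ++ r : seqlexi L))%O.
Proof.
move=> st lt; elim: p => [|a p IH] /=; last by rewrite ltxi_cons lexx IH.
elim: s t st lt => [|a s IH] [|b t] //= [st].
by rewrite !ltxi_cons => /andP[-> /implyP H]; apply/implyP=> /H; apply: IH.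
Qed.

Lemma pairmap_descent (T L : Type) (lam : T -> T -> L) (e : rel L) x s :
  ~~ sorted e (pairmap lam x s) ->
  exists s1 p q s2, s = s1 ++ p :: q :: s2 /\ ~~ e (lam (last x s1) p) (lam p q).
Proof.
elim: s x => // p s IH x /=; case: s IH => //= q s IH; rewrite negb_and.
case: (boolP (e _ _)) => [_|epq _]; last by exists [::], p, q, s.
case/(IH p) => s1 [p' [q' [s2 [-> H]]]].
by exists (p :: s1), p', q', s2.
Qed.

(** * Lexicographic shelling of a graded bounded poset with an EL-labeling *)

Section GradedEL.
Variables (disp : Order.disp_t) (P : finPOrderType disp).
Variables (d : Order.disp_t) (L : porderType d) (lam : P -> P -> L) (rk : P -> nat).
Implicit Types (x y z : P) (s t : seq P).
Hypothesis EL : EL_labeling lam.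
Hypothesis graded : forall x y, covered x y -> rk y = (rk x).+1.
Local Open Scope order_scope.

Let rk_chain x y s : saturated_chain x y s -> rk y = (rk x + size s)%N.
Proof.
case/andP=> + /eqP <-; elim: s x => [|z s IH] x /=; first by rewrite addn0.
by case/andP=> /graded xz /IH->; rewrite xz addnS addSn.
Qed.

Let size_chain x y s t : saturated_chain x y s -> saturated_chain x y t -> size s = size t.
Proof. by move=> /rk_chain + /rk_chain; lia. Qed.

Let rk_lt x y : x < y -> (rk x < rk y)%N.
Proof.
move=> xy; have [s [ss _ _ _]] := EL (ltW xy).
case: s ss => [/andP[_ /eqP e]|z s /rk_chain->]; first by move: xy; rewrite -e ltxx.
by rewrite addnS ltnS leq_addr.
Qed.

(* Between the point where s and t separate and the next element they share, s cannot be increasing; the increasing chain around a descent of s there removes exactly one element of s outside t. *)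
Lemma EL_chain_exchange x y s t :
  saturated_chain x y s -> saturated_chain x y t -> s <> t ->
  ~ ((labels lam x s : seqlexi L) < (labels lam x t : seqlexi L)) ->
  exists s' z,
    [/\ saturated_chain x y s',
        (labels lam x s' : seqlexi L) < (labels lam x s : seqlexi L),
        z \in x :: s, z \notin x :: t
      & forall v, v \in x :: s -> v != z -> v \in x :: s'].
Proof.
elim: s x t => [|u s IH] x t ss tt st nlt.
  by case: t tt st {nlt} => [_ /(_ erefl)|w t tt]; last have := size_chain ss tt.
case: t tt st nlt => [tt|w t tt st nlt]; first by have := size_chain ss tt.
have consP v r : saturated_chain x y (v :: r) ->
    [/\ covered x v, path (@covered _ P) v r & last v r = y].
  by case/andP=> /= /andP[? ?] /eqP.
have [xu us ls] := consP _ _ ss; have [xw wt lt] := consP _ _ tt.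
have xs z : z \in u :: s -> x < z.
  by case/andP: ss => p _; apply: covered_path_gt p.
have [uw|uw] := eqVneq u w.
  have [||||s' [z [ss' lt' zs zt sub]]] := IH u t.
  - by rewrite /saturated_chain us ls /=.
  - by rewrite uw /saturated_chain wt lt /=.
  - by move=> e; case: st; rewrite uw e.
  - by move=> l; apply: nlt; rewrite -uw /= ltxi_cons lexx.
  exists (u :: s'), z; case/andP: ss' => p' l'; split.
  - by rewrite /saturated_chain /= xu p'.
  - by rewrite /= ltxi_cons lexx.
  - by rewrite inE zs orbT.
  - by rewrite inE negb_or -uw zt andbT gt_eqF ?xs.
  move=> v; rewrite in_cons => /predU1P[-> _|vs vz]; first exact: mem_head.
  by rewrite in_cons sub ?orbT.
have uNt : u \notin w :: t.
  rewrite inE (negPf uw) /=; apply/negP=> ut.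
  have [_ /(_ w (covered_lt xw))] := coveredP _ _ xu.
  rewrite (ltW (covered_path_gt wt ut)) => /(_ isT) e; by rewrite e eqxx in uw.
have hs : has [in w :: t] (u :: s).
  by apply/hasP; exists y; rewrite -?ls ?lt ?mem_last // ls -lt mem_last.
(* [a] is the first element of [s] that is also on [t]; everything in [sa] is off [t]. *)
have [a [sa [sb [at_ nsa es]]]] : exists a sa sb,
    [/\ a \in w :: t, ~~ has [in w :: t] sa & u :: s = sa ++ a :: sb].
  case: (split_find_nth x hs) => a sa sb at_ nsa; exists a, sa, sb; split=> //.
  by rewrite cat_rcons.
have usa : u \in sa.
  by case: sa es {nsa} => [[ua _]|v sa [-> _]]; rewrite ?mem_head // -ua (negPf uNt) in at_ *.
have saNt z : z \in sa -> z \notin w :: t.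
  by move=> zs; apply: contra nsa => zt; apply/hasP; exists z.
have [ta [tb et]] : exists ta tb, w :: t = ta ++ a :: tb.
  by case/splitPr: at_ => ta tb; exists ta, tb.
rewrite es et in ss tt nlt.
have split_chain r1 r2 : saturated_chain x y (r1 ++ a :: r2) ->
    saturated_chain x a (rcons r1 a) /\ saturated_chain a y r2.
  rewrite /saturated_chain -cat_rcons cat_path last_cat !last_rcons.
  by rewrite -andbA => /and3P[-> -> ->]; rewrite eqxx.
have [ssa ssb] := split_chain _ _ ss; have [sta stb] := split_chain _ _ tt.
have labE r1 r2 : labels lam x (r1 ++ a :: r2) = labels lam x (rcons r1 a) ++ labels lam a r2.
  by rewrite -cat_rcons /labels pairmap_cat last_rcons.
have xa : x <= a by case/andP: ssa => /covered_path_last; rewrite last_rcons.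
(* An increasing segment would be the lexicographically first chain of [[x, a]]. The two segments up
   to [a] have equal length by the grading, so [s] would then precede [t]. *)
have ninc : ~~ sorted <=%O (pairmap lam x (rcons sa a)).
  apply/negP=> inc; have [r [_ _ runiq rmin]] := EL xa.
  have rE := runiq _ ssa inc; apply: nlt; rewrite !labE.
  apply: (@lt_seqlexi_cat _ _ [::]).
    by rewrite /labels !size_pairmap (size_chain ssa sta).
  rewrite rE; apply: rmin => //; rewrite -rE => /rcons_inj[e].
  by have := saNt u usa; rewrite et e mem_cat usa.
have [s1 [p [q [s2 [esa desc]]]]] := pairmap_descent ninc.
have psa : p \in sa.
  move: esa; rewrite lastI -rcons_cat => /rcons_inj[-> _].
  by rewrite mem_cat mem_head orbT.
have [ps1 op pq ps2 ls2] : [/\ path (@covered _ P) x s1, covered (last x s1) p,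
    covered p q, path (@covered _ P) q s2 & last q s2 == a].
  by move: ssa; rewrite esa /saturated_chain cat_path last_cat => /andP[/= /and4P[]].
set o := last x s1 in op desc.
have oq : o <= q by rewrite ltW // (lt_trans (covered_lt op) (covered_lt pq)).
have spq : saturated_chain o q [:: p; q] by rewrite /saturated_chain /= op pq eqxx.
have [r [sr incr runiq rmin]] := EL oq.
have rpq : [:: p; q] <> r.
  by move=> e; move: incr; rewrite -e /= andbT; apply/negP.
have es' : u :: s = s1 ++ [:: p; q] ++ s2 ++ sb by rewrite es -cat_rcons esa -catA.
exists (s1 ++ r ++ s2 ++ sb), p; split.
- apply: (saturated_chain_cat (y := o)); first by rewrite /saturated_chain ps1 /=.
  apply: saturated_chain_cat sr _; apply: saturated_chain_cat ssb.
  by rewrite /saturated_chain ps2.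
- rewrite es' /labels !(pairmap_cat lam x s1) !(pairmap_cat lam (last x s1)).
  apply: lt_seqlexi_cat; first by rewrite !size_pairmap (size_chain sr spq).
  exact: rmin spq rpq.
- by rewrite es inE mem_cat psa orbT.
- by rewrite inE negb_or saNt // andbT gt_eqF // xs // es mem_cat psa.
have qr : q \in r.
  have /andP[_ /eqP] := sr; case: r {sr incr runiq rmin rpq} => [e|v r /= <-]; last exact: mem_last.
  by move: (lt_trans (covered_lt op) (covered_lt pq)); rewrite -e ltxx.
rewrite es' => z + zp; rewrite !(inE, mem_cat) (negPf zp) /= => /or4P[->|->|/eqP->|]; rewrite ?qr ?orbT //.
by case/orP=> ->; rewrite ?orbT.
Qed.
(** The facets are the saturated chains from bottom to top. By the grading they all have the same
    length [N], so they are enumerated as tuples; [EL_chain_exchange] is the exchange condition for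
    any listing that respects the lexicographic order. *)
Lemma graded_EL_shellable : bounded P -> shellable P.
Proof.
case=> -[b bmin] [e emax]; pose N := (rk e - rk b)%N.
pose chains : seq (seq P) :=
  [seq tval u | u <- enum {: N.-tuple P} & saturated_chain b e (tval u)].
have chainsP s : (s \in chains) = saturated_chain b e s.
  apply/mapP/idP => [[t]|ss]; first by rewrite mem_filter => /andP[? _] ->.
  have sz : size s == N by rewrite /N (rk_chain ss) addKn.
  by exists (Tuple sz); rewrite // mem_filter ss mem_enum.
have chains_uniq : uniq chains.
  by rewrite map_inj_uniq ?filter_uniq -?enumT ?enum_uniq //; apply: val_inj.
(* Sorting by the number of lexicographically smaller chains gives a linear extension of the lexicographic order, even when L is only partially ordered. *)
pose smaller s := [set u : N.-tuple P | saturated_chain b e u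
  && ((labels lam b u : seqlexi L) < (labels lam b s : seqlexi L))].
pose h s := #|smaller s|.
have h_lt s t : s \in chains ->
    (labels lam b s : seqlexi L) < (labels lam b t : seqlexi L) -> (h s < h t)%N.
  rewrite chainsP => ss st; apply/proper_card/properP; split.
    by apply/subsetP=> u; rewrite !inE => /andP[-> /lt_trans]; apply.
  have sz : size s == N by rewrite /N (rk_chain ss) addKn.
  by exists (Tuple sz); rewrite inE /= ss ?st // ltxx.
pose cs := sort (relpre h leq) chains.
have csP s : (s \in cs) = saturated_chain b e s by rewrite mem_sort chainsP.
have cs_h i j : (i <= j < size cs)%N -> (h (nth [::] cs i) <= h (nth [::] cs j))%N.
  move=> /andP[ij jc]; have ic := leq_ltn_trans ij jc.
  have tr : transitive (relpre h leq) by move=> ? ? ?; apply: leq_trans.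
  have rf : reflexive (relpre h leq) by move=> ?; apply: leqnn.
  apply: (sorted_leq_nth tr rf) ij => //.
  by apply: sort_sorted => ? ?; apply: leq_total.
exists [seq [set x in b :: s] | s <- cs]; apply/shellingP; split.
- rewrite map_inj_in_uniq ?sort_uniq // => s t; rewrite !csP => /andP[ps _] /andP[pt _] /setP st.
  suff [] : b :: s = b :: t by [].
  apply: lt_sorted_eq; try exact: covered_path_lt.
  by move=> x; have := st x; rewrite !in_set.
- move=> F; apply/mapP/idP => [[s]|Ff].
    by rewrite csP => ss ->; apply: saturated_chain_facet ss => z; rewrite bmin emax.
  have /facetsP[/order_complexP Fch Fmax] := Ff.
  (* To see that a facet is a saturated chain, list it by rank and fill each gap with a saturated
     chain supplied by the EL-labeling; maximality shows that nothing was added. *)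
  pose s0 := sort (relpre rk leq) (enum F).
  have s0F x : (x \in s0) = (x \in F) by rewrite mem_sort mem_enum.
  have srt : sorted <=%O s0.
    have : sorted (relpre rk leq) s0 by apply: sort_sorted => ? ?; apply: leq_total.
    apply: (sub_in_sorted (P := [in F])); last by apply/allP=> x; rewrite s0F.
    move=> x y xF yF /= rxy; have /orP[//|] := Fch _ _ xF yF.
    by rewrite le_eqVlt => /predU1P[->//|/rk_lt]; rewrite ltnNge rxy.
  have refine x r : path <=%O x r -> exists s, saturated_chain x (last x r) s
      /\ {subset x :: r <= x :: s}.
    elim: r x => [|y r IH] x /=; first by exists [::]; split=> //; rewrite /saturated_chain /=.
    case/andP=> xy /IH[s2 [ss2 sub2]]; have [s1 [ss1 _ _ _]] := EL xy.
    exists (s1 ++ s2); split; first exact: saturated_chain_cat ss1 ss2.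
    move=> z; rewrite in_cons => /predU1P[->|/sub2]; first exact: mem_head.
    have yx : y \in x :: s1 by case/andP: ss1 => _ /eqP<-; apply: mem_last.
    by rewrite [in X in X -> _]in_cons -cat_cons mem_cat => /predU1P[->|->]; rewrite ?yx ?orbT.
  have pth : path <=%O b (rcons s0 e).
    rewrite rcons_path emax andbT.
    by case: {s0F} s0 srt => //= x r ->; rewrite bmin.
  have [s [ss sub]] := refine _ _ pth; rewrite last_rcons in ss.
  exists s; first by rewrite csP.
  have /facetsP[sch _] : [set x in b :: s] \in facets (order_complex P).
    by apply: saturated_chain_facet ss => z; rewrite bmin emax.
  rewrite (Fmax _ sch) //; apply/subsetP=> x xF; rewrite in_set.
  by apply: sub; rewrite !inE mem_rcons inE s0F xF !orbT.
move=> i k; rewrite size_map => /andP[ik ks]; have si := ltn_trans ik ks.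
rewrite !(nth_map [::]) //; set s := nth _ _ k; set t := nth _ _ i.
have [ss tt] : saturated_chain b e s /\ saturated_chain b e t.
  by rewrite -!csP !mem_nth.
have nst : s <> t by apply/eqP; rewrite nth_uniq ?sort_uniq // gtn_eqF.
have nlt : ~ (labels lam b s : seqlexi L) < (labels lam b t : seqlexi L).
  move=> lt; have sc : s \in chains by rewrite chainsP.
  have := h_lt s t sc lt; apply/negP; rewrite -leqNgt.
  by apply: cs_h; rewrite ltnW.
have [s' [z [ss' lt' zs zt sub]]] := EL_chain_exchange ss tt nst nlt.
have s'c : s' \in cs by rewrite csP.
exists (index s' cs), z; rewrite !in_set; split=> //.
  rewrite ltnNge; apply/negP=> ki.
  have sc' : s' \in chains by rewrite chainsP.
  have := h_lt s' s sc' lt'; apply/negP; rewrite -leqNgt -[s'](nth_index [::] s'c).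
  by apply: cs_h; rewrite ki index_mem.
rewrite (nth_map [::]) ?index_mem // nth_index //.
by apply/subsetP=> x; rewrite in_setD1 !in_set => /andP[xz xs]; apply: sub.
Qed.

End GradedEL.

(* A cover is labeled by the coordinate it raises; the increasing chain of an interval raises the coordinates from left to right. *)
Section VectorPoset.
Variables (disp : Order.disp_t) (P : finPOrderType disp) (n : nat) (f : P -> nat -> nat).
Implicit Types (x y z : P) (s t : seq P).
Hypothesis leP : forall x y, (x <= y)%O <-> (forall i, i < n -> f x i <= f y i).
(** Only the first coordinate in which the vectors differ has to be raisable: this is the one the
    increasing chain raises. *)
Hypothesis raise : forall x y i, (x <= y)%O -> i < n -> f x i < f y i ->
  (forall k, k < i -> f x k = f y k) ->
  exists z, forall k, k < n -> f z k = f x k + (k == i).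

Let lam x y := find (fun i => f x i < f y i) (iota 0 n).

Let eq_f x y : (forall i, i < n -> f x i = f y i) -> x = y.
Proof. by move=> e; apply: le_anti; apply/andP; split; apply/leP=> i /e->. Qed.

Let lamP x y : (x < y)%O -> [/\ lam x y < n, f x (lam x y) < f y (lam x y)
  & forall k, k < lam x y -> f x k = f y k].
Proof.
move=> xy; have /leP le := ltW xy.
have hs : has (fun i => f x i < f y i) (iota 0 n).
  apply: contraTT xy => /hasPn H; have -> : x = y; last by rewrite ltxx.
  apply: eq_f => i i_n; have := H i; rewrite mem_iota /= => /(_ i_n).
  by have := le i i_n; lia.
have ln : lam x y < n by rewrite -[X in _ < X](size_iota 0 n) -has_find.
split=> //; first by have := nth_find 0 hs; rewrite nth_iota.
move=> k kl; have := before_find 0 kl; rewrite nth_iota ?(ltn_trans kl) //= add0n.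
by have := le k (ltn_trans kl ln); lia.
Qed.

Let stepP x y i : i < n -> (forall k, k < n -> f y k = f x k + (k == i)) ->
  covered x y /\ lam x y = i.
Proof.
move=> i_n e; have lt : (x < y)%O.
  rewrite lt_neqAle; apply/andP; split.
    by apply: contraTneq i_n => xy; have := e i; rewrite xy eqxx; lia.
  by apply/leP=> k /e->; rewrite leq_addr.
split; last first.
  have [ln + _] := lamP lt; rewrite e //; case: eqP => //; lia.
apply/coveredP; split=> // z xz /leP zy; apply: eq_f => k kn.
have [ln l1 _] := lamP xz; have /leP xz' := ltW xz.
have := zy k kn; have := xz' k kn; rewrite e //; case: eqP => [ki|]; last lia.
have := zy _ ln; rewrite e //; case: eqP => [li|]; last lia.
by move: l1; rewrite li -ki; lia.
Qed.

(** Raising the first differing coordinate by one yields an element above [x] and at most [y], so a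
    cover is such a unit step. *)
Let coveredE x y : covered x y ->
  lam x y < n /\ forall k, k < n -> f y k = f x k + (k == lam x y).
Proof.
move=> cxy; have xy := covered_lt cxy; have [ln lt eqs] := lamP xy; split=> //.
have [z zE] := raise (ltW xy) ln lt eqs.
have [cxz _] := stepP ln zE; have [_ only] := coveredP _ _ cxy.
suff zy : z = y by move=> k kn; rewrite -{1}zy zE.
apply: only; first exact: covered_lt.
apply/leP=> k kn; rewrite zE //; have /leP /(_ k kn) := ltW xy.
by case: eqP => [->|_]; lia.
Qed.

Lemma vector_poset_graded x y : covered x y ->
  \sum_(k < n) f y k = (\sum_(k < n) f x k).+1.
Proof.
case/coveredE=> ln e; rewrite (eq_bigr (fun k : 'I_n => f x k + (k == Ordinal ln))) => [|k _].
  by rewrite big_split /= -big_mkcond big_pred1_eq addn1.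
exact: e.
Qed.

Let mem_labels x s i : path (@covered _ P) x s -> i < n -> f x i < f (last x s) i ->
  i \in labels lam x s.
Proof.
elim: s x => [|y s IH] x /=; first by rewrite ltnn.
case/andP=> /coveredE[ln e] ys i_n lt; rewrite inE; case: eqP => //= ni.
by apply: IH => //; rewrite e //; case: eqP; lia.
Qed.

(** Let [i] be the first coordinate that grows from [x] to [y]. No chain can begin with a label
    below [i], and [i] occurs on every chain because that coordinate must grow; an increasing chain
    therefore begins with [i]. The label determines the first step, and the induction on the total
    growth continues above it. *)
Lemma vector_poset_EL_labeling : EL_labeling lam.
Proof.
have lam_ge x y z : covered x y -> (y <= z)%O -> (x < z)%O -> lam x z <= lam x y.
  move=> /covered_lt xy /leP yz xz; have [_ _ eqs] := lamP xz.
  have [ln lt _] := lamP xy; rewrite leqNgt; apply/negP=> /eqs e.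
  by have := yz _ ln; lia.
move=> x y; move: {2}(\sum_(k < n) (f y k - f x k)).+1 (ltnSn (\sum_(k < n) (f y k - f x k))) => m.
elim: m x => // m IH x bnd xy; have [->|nxy] := eqVneq x y.
  exists [::]; split=> //; first by rewrite /saturated_chain /= eqxx.
    by move=> t /saturated_chain_nil.
  by move=> t /saturated_chain_nil.
have lt : (x < y)%O by rewrite lt_neqAle nxy.
have [ln flt eqs] := lamP lt; have [z zE] := raise xy ln flt eqs.
have [cxz lxz] := stepP ln zE.
have zy : (z <= y)%O.
  by apply/leP=> k kn; rewrite zE //; have /leP/(_ k kn) := xy; case: eqP => [->|]; lia.
have [|s [/andP[ps ls] inc suniq smin]] := IH z _ zy.
  rewrite -ltnS; apply: leq_trans bnd; rewrite ltnS (bigD1 (Ordinal ln)) //= [leqRHS](bigD1 (Ordinal ln)) //=.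
  rewrite -addSn leq_add //; first by rewrite zE // eqxx; lia.
  by apply: leq_sum => k _; rewrite zE //; lia.
have cons_chain t : saturated_chain x y t -> exists w t',
    [/\ t = w :: t', covered x w, saturated_chain w y t' & (w <= y)%O].
  case: t => [/andP[_ /=]|w t /andP[/= /andP[xw wt] lt']]; first by rewrite (negPf nxy).
  exists w, t; rewrite /saturated_chain wt lt'; split=> //.
  by rewrite -(eqP lt') covered_path_last.
have first_z w : covered x w -> lam x w = lam x y -> w = z.
  by move=> /coveredE[_ e] l; apply: eq_f => k kn; rewrite e // zE // l.
exists (z :: s); split.
- by rewrite /saturated_chain /= cxz ps.
- rewrite /= lxz; case: s ps ls inc {suniq smin} => //= w s /andP[zw ws] /eqP ls ->.
  rewrite andbT; have [ln' l1 _] := lamP (covered_lt zw).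
  rewrite leEnat leqNgt; apply/negP=> l.
  have /leP/(_ _ ln') wy : (w <= y)%O by rewrite -ls covered_path_last.
  by have := eqs _ l; move: l1; rewrite zE //; lia.
- move=> t /cons_chain[w [t' [-> xw tw wy]]] inct.
  have lw := lam_ge _ _ _ xw wy lt.
  have lwE : lam x w = lam x y.
    apply/eqP; rewrite eqn_leq lw andbT.
    case: (ltngtP (lam x y) (lam x w)) lw => // lw _.
    have /andP[pw /eqP lw'] := tw.
    have : lam x y \in labels lam w t'.
      apply: mem_labels => //; rewrite lw'; have [_ e] := coveredE xw.
      by rewrite e // (ltn_eqF lw) addn0.
    have /allP le_all := order_path_min le_trans inct.
    by move=> /le_all; rewrite leEnat leqNgt lw.
  have wz := first_z w xw lwE; rewrite wz in tw inct *.
  by rewrite (suniq t' tw) //; apply: path_sorted inct.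
move=> t /cons_chain[w [t' [-> xw tw wy]]] nt.
have lw := lam_ge _ _ _ xw wy lt.
rewrite /= ltxi_cons lxz leEnat lw /=; apply/implyP=> lw2.
have lwE : lam x w = lam x y by apply/eqP; rewrite eqn_leq lw2 lw.
have wz := first_z w xw lwE; rewrite wz in tw nt *.
by apply: smin => // e; apply: nt; rewrite e.
Qed.

Lemma vector_poset_EL_shellable : bounded P -> EL_shellable P.
Proof.
by move=> bP; split=> //; exists _, nat, lam; apply: vector_poset_EL_labeling.
Qed.

Lemma vector_poset_shellable : bounded P -> shellable P.
Proof. exact: graded_EL_shellable vector_poset_EL_labeling vector_poset_graded. Qed.

End VectorPoset.

(** * Kohnert moves *)

Local Open Scope fset_scope.

Section Moves.
Implicit Types (D T X Y : cells).

Lemma in_row_cols D r c : (c \in row_cols D r) = ((r, c) \in D).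
Proof.
apply/imfsetP/idP => [[[i j] /=]|rc]; last by exists (r, c); rewrite // inE /= rc eqxx.
by rewrite inE /= => /andP[ij /eqP<-] ->.
Qed.

Lemma in_free_below D r c q : (q \in free_below D r c) = (0 < q < r) && ((q, c) \notin D).
Proof. by rewrite !inE /= mem_iota; congr andb; lia. Qed.

Lemma bigmax_fset_eq (A : {fset nat}) m :
  m \in A -> (forall i, i \in A -> i <= m) -> \max_(i <- A) i = m.
Proof.
move=> mA ub; apply/eqP; rewrite eqn_leq; apply/andP; split.
  by apply/bigmax_leqP_seq => i iA _; apply: ub.
exact: leq_bigmax_seq.
Qed.

Definition kohnert_step D r c q : Prop :=
  [/\ (r, c) \in D, forall c', c < c' -> (r, c') \notin D, 0 < q < r,
      (q, c) \notin D & forall t, q < t < r -> (t, c) \in D].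

Lemma kohnert_stepE D r c q :
  kohnert_step D r c q -> kohnert_move D r = (q, c) |` (D `\ (r, c)).
Proof.
case=> rcD right qr qD between.
have rc : c \in row_cols D r by rewrite in_row_cols.
have qf : q \in free_below D r c by rewrite in_free_below qr.
have cE : \max_(j <- row_cols D r) j = c.
  apply: bigmax_fset_eq => // j; rewrite in_row_cols leqNgt => jD.
  by apply: contraL jD; apply: right.
have qE : \max_(i <- free_below D r c) i = q.
  apply: bigmax_fset_eq => // i; rewrite in_free_below => /andP[i_r iD].
  by rewrite leqNgt; apply: contra iD => qi; apply: between; lia.
rewrite /kohnert_move; case: eqP => [e|_]; first by rewrite e in rc.
by rewrite cE; case: eqP => [e|_]; [rewrite e in qf | rewrite qE].
Qed.

Lemma kohnert_move_cases D r :
  kohnert_move D r = D \/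
  exists c q, kohnert_step D r c q /\ kohnert_move D r = (q, c) |` (D `\ (r, c)).
Proof.
have [C0|C0] := eqVneq (row_cols D r) fset0; first by left; rewrite /kohnert_move C0 eqxx.
set c := \max_(j <- row_cols D r) j.
have [E0|E0] := eqVneq (free_below D r c) fset0.
  by left; rewrite /kohnert_move (negPf C0) -/c E0 eqxx.
right; exists c, (\max_(i <- free_below D r c) i).
suff step : kohnert_step D r c (\max_(i <- free_below D r c) i).
  by split=> //; apply: kohnert_stepE.
have := bigmax_mem C0; rewrite in_row_cols => rc.
have := bigmax_mem E0; rewrite in_free_below => /andP[qr qD].
split=> // [j cj|t /andP[qt tr]].
  apply: contraL cj; rewrite -in_row_cols -leqNgt => jc.
  exact: (leq_bigmax_seq (F := id)).
apply: contraLR (qt) => tD; rewrite -leqNgt.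
apply: (leq_bigmax_seq (F := id)) => //; rewrite in_free_below tD tr !andbT.
by case/andP: qr; lia.
Qed.

Lemma kohnert_step_reach D r c q :
  kohnert_step D r c q -> kohnert_reach D ((q, c) |` (D `\ (r, c))).
Proof. by move=> st; exists [:: r]; rewrite /= (kohnert_stepE st). Qed.

(** Induction along the moves that remembers that [T] is still reachable. This extra premise is what
    excludes moves leading out of an interval. *)
Lemma kohnert_reach_ind (Q : cells -> Prop) D T :
  (forall X r c q, Q X -> kohnert_step X r c q ->
     kohnert_reach ((q, c) |` (X `\ (r, c))) T -> Q ((q, c) |` (X `\ (r, c)))) ->
  kohnert_reach D T -> Q D -> Q T.
Proof.
move=> IH [rs]; elim: rs D => [|r rs IHr] D /= TE QD; first by rewrite TE.
apply: (IHr _ TE); case: (kohnert_move_cases D r) => [->//|[c [q [st e]]]].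
by rewrite e; apply: IH => //; exists rs; rewrite -e.
Qed.

(** No move increases these counts, so a diagram whose count is too small can no longer reach a
    given target. *)
Definition col_count D c t := \sum_(x <- D) ((x.2 == c) && (t <= x.1)).

Lemma col_countU1 D x c t : x \notin D ->
  col_count (x |` D) c t = (((x.2 == c) && (t <= x.1)) + col_count D c t)%N.
Proof. exact: big_fsetU1. Qed.

Lemma col_count_step D r c q x t : kohnert_step D r c q ->
  (col_count ((q, c) |` (D `\ (r, c))) x t + ((x == c) && (q < t <= r)))%N = col_count D x t.
Proof.
case=> rcD _ /andP[_ qr] qD _; rewrite col_countU1 ?inE ?(negPf qD) ?andbF //=.
rewrite /col_count (big_fsetD1 (r, c) rcD) /= eq_sym.
by case: (x == c) => //=; lia.
Qed.

Lemma col_count_reach D T c t : kohnert_reach D T -> col_count T c t <= col_count D c t.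
Proof.
move=> DT; apply: (kohnert_reach_ind (Q := fun X => col_count X c t <= col_count D c t)) DT _ => //.
by move=> X r c' q le st _; have := col_count_step c t st; lia.
Qed.

Lemma wtE T i : wt T i = \sum_(x <- T) (x.1 == i).
Proof.
rewrite cmE fsfun_fun; case: ifP => [_|/negbT iT].
  by rewrite card_fset_sum1 -big_fset_condE big_mkcond; apply: eq_bigr => x _; case: eqP.
rewrite big_seq big1 // => x xT; apply/eqP; rewrite eqb0; apply: contra iT => /eqP<-.
exact: in_imfset.
Qed.

Lemma eq_wt T X :
  wt T = wt X <-> forall i, \sum_(x <- T) (x.1 == i) = \sum_(x <- X) (x.1 == i).
Proof.
by split=> [e i|e]; [rewrite -!wtE e | apply/eqP/cmP => i; rewrite !wtE e].
Qed.

Lemma coef_kohnert_poly D m :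
  (kohnert_poly D)@_m%R = ((\sum_(T <- KD D) (wt T == m))%N%:R : int)%R.
Proof.
rewrite /kohnert_poly GRing.raddf_sum /= GRing.natr_sum.
by apply: eq_bigr => T _; rewrite mcoeffU1.
Qed.

Lemma multiplicity_freeP D :
  multiplicity_free (kohnert_poly D) <->
  (forall T U, kohnert_reach D T -> kohnert_reach D U -> wt T = wt U -> T = U).
Proof.
split=> [mf T U /KDP TD /KDP UD TU|inj m]; last first.
  rewrite coef_kohnert_poly.
  have [/hasP[T TD /eqP TE]|/hasPn no] := boolP (has (fun T => wt T == m) (KD D)).
    right; rewrite (big_fsetD1 T) //= TE eqxx big_seq big1 ?addn0 // => U.
    rewrite in_fsetD1 => /andP[UT UD]; apply/eqP; rewrite eqb0.
    apply: contra UT => /eqP UE; apply/eqP.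
    by apply: inj; [exact/KDP | exact/KDP | rewrite UE TE].
  by left; rewrite big_seq big1 // => T /no/negPf->.
apply/eqP; apply: contraT => nTU; have := mf (wt T); rewrite coef_kohnert_poly.
have UD' : U \in KD D `\ T by rewrite in_fsetD1 eq_sym nTU.
rewrite (big_fsetD1 T) //= (big_fsetD1 U) //= TU eqxx.
by case; lia.
Qed.

(** * Hexagonal intervals in Kohnert posets *)

Section DiagramHexagon.
Variables (E : cells) (c c' p : nat).
Hypotheses (cc' : c < c') (p_gt0 : 0 < p).
Hypotheses (E_c : (p, c) \notin E /\ (p.+1, c) \notin E).
Hypotheses (E_c' : [/\ (p, c') \notin E, (p.+1, c') \notin E & (p.+2, c') \notin E]).
Hypotheses (row1 : forall k, c < k -> (p.+1, k) \notin E)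
           (row2 : forall k, c' < k -> (p.+2, k) \notin E).

(** [E] is the part that stays put. The top of the interval is [H p.+1 p.+2] and the bottom [H p p];
    [I] and [J] list the rows open to the left and to the right cell. *)
Let H i j : cells := (i, c) |` ((j, c') |` E).
Let I i := (i == p) || (i == p.+1).
Let J j := [|| j == p, j == p.+1 | j == p.+2].

Let HE i j x y : ((x, y) \in H i j) =
  [|| (x == i) && (y == c), (x == j) && (y == c') | (x, y) \in E].
Proof. by rewrite !inE !xpair_eqE. Qed.

Let IE i : I i -> (i, c) \notin E.
Proof. by case/orP=> /eqP->; case: E_c. Qed.

Let JE j : J j -> (j, c') \notin E.
Proof. by case/or3P=> /eqP->; case: E_c'. Qed.

Let H_count i j x t : I i -> J j -> col_count (H i j) x t =
  (((c == x) && (t <= i)) + (((c' == x) && (t <= j)) + col_count E x t))%N.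
Proof.
move=> /IE iE /JE jE; rewrite /H !col_countU1 // !inE negb_or iE andbT xpair_eqE.
by rewrite (ltn_eqF cc') andbF.
Qed.

Let H_inj i j i' j' : I i -> J j -> I i' -> J j' -> H i j = H i' j' -> i = i' /\ j = j'.
Proof.
move=> Ii Jj Ii' Jj' e; split.
  have : (i, c) \in H i' j' by rewrite -e HE !eqxx.
  by rewrite HE (negPf (IE Ii)) eqxx (ltn_eqF cc') andbF andbT !orbF => /eqP.
have : (j, c') \in H i' j' by rewrite -e HE !eqxx orbT.
by rewrite HE (negPf (JE Jj)) eqxx (gtn_eqF cc') andbF andbT !orbF => /eqP.
Qed.

Let Ip : I p. Proof. by rewrite /I eqxx. Qed.
Let Ip1 : I p.+1. Proof. by rewrite /I eqxx orbT. Qed.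
Let Jp : J p. Proof. by rewrite /J eqxx. Qed.
Let Jp1 : J p.+1. Proof. by rewrite /J eqxx orbT. Qed.
Let Jp2 : J p.+2. Proof. by rewrite /J eqxx !orbT. Qed.

Let H_left i i' j : I i -> J j -> (i', c) |` (H i j `\ (i, c)) = H i' j.
Proof.
move=> /IE iE Jj; apply/fsetP=> -[x y]; rewrite !(HE, inE, xpair_eqE).
case: (eqVneq y c) => [->|_]; rewrite ?andbF //= !andbT (ltn_eqF cc') !andbF /=.
by case: (eqVneq x i) => [->|] //=; rewrite (negPf iE) orbF.
Qed.

Let H_right i j j' : I i -> J j -> (j', c') |` (H i j `\ (j, c')) = H i j'.
Proof.
move=> Ii /JE jE; apply/fsetP=> -[x y]; rewrite !(HE, inE, xpair_eqE).
case: (eqVneq y c') => [->|_]; rewrite ?andbF //= !andbT (gtn_eqF cc') !andbF /=.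
by case: (eqVneq x j) => [->|] //=; rewrite (negPf jE) orbF.
Qed.

(* The column counts of the two ends pin down which cells can move. *)
Let H_step i j r x q : I i -> J j -> kohnert_step (H i j) r x q ->
  kohnert_reach ((q, x) |` (H i j `\ (r, x))) (H p p) ->
  [/\ i = p.+1, j != p.+1 & (q, x) |` (H i j `\ (r, x)) = H p j] \/
  (p < j /\ (q, x) |` (H i j `\ (r, x)) = H i j.-1).
Proof.
move=> Ii Jj st rch; have [rH right qr qH btw] := st.
(* Each threshold crossed by the move loses one cell, and the remaining count must still be at least
   that of [H p p]; the contributions of [E] cancel. *)
have cnt t : q < t <= r -> ((c == x) && (t <= p)) + ((c' == x) && (t <= p))
    < ((c == x) && (t <= i)) + ((c' == x) && (t <= j)).
  move=> qt; have e := col_count_step x t st; rewrite eqxx qt addn1 in e.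
  by have := col_count_reach x t rch; rewrite -ltnS e !H_count // !addnA ltn_add2r.
have cr := cnt r; have cq := cnt q.+1.
have [xc|xc] := eqVneq c x.
  move: cr cq Ii; rewrite -xc eqxx (gtn_eqF cc') /I => cr cq Ii.
  have {}cr := cr (ltac:(clear -qr; lia)); have {}cq := cq (ltac:(clear -qr; lia)).
  have [ip ri qp] : [/\ i = p.+1, r = i & q = p].
    by move: cr cq Ii qr; clear; rewrite !addn0 => cr cq Ii qr; split; lia.
  left; rewrite ri qp H_left //.
  split=> //; apply: contraNneq (right c' _) => [jp|]; last by rewrite -xc.
  by rewrite HE ri ip jp !eqxx orbT.
have [xc'|xc'] := eqVneq c' x; last first.
  by have := cr (ltac:(clear -qr; lia)); rewrite (negPf xc) (negPf xc').
move: cr cq Jj; rewrite (negPf xc) xc' eqxx /J => cr cq Jj.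
have {}cr := cr (ltac:(clear -qr; lia)); have {}cq := cq (ltac:(clear -qr; lia)).
have [pq rj pj] : [/\ p <= q, r <= j & p < j].
  by move: cr cq Jj qr; clear; rewrite !add0n => cr cq Jj qr; split; lia.
have rE : (r, c') \notin E by apply: JE; move: Jj pq rj qr; clear; rewrite /J; lia.
have rjE : r = j.
  by move: rH; rewrite HE -xc' (negPf rE) (gtn_eqF cc') eqxx andbF !orbF andbT => /eqP.
have qj : q = j.-1.
  have : ~~ (q < p.+1 < r).
    apply/negP=> pr; have := btw _ pr; rewrite HE -xc' eqxx (gtn_eqF cc') andbF andbT.
    by rewrite (negPf (JE Jp1)) orbF; move: pr; rewrite rjE; clear; lia.
  by move: Jj pq qr; rewrite rjE; clear; lia.
by right; split=> //; rewrite rjE qj -xc' H_right.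
Qed.

(** The two sides of the hexagon. On the side [V] the right cell enters row [p.+1] while the left
    one is there, so it has to go down to row [p] before the left cell can move. *)
Let U X := [\/ X = H p p.+2, X = H p p.+1 | X = H p p].
Let V X := [\/ X = H p.+1 p.+1, X = H p.+1 p | X = H p p].

Let reachU X Y : U X -> kohnert_reach X Y -> kohnert_reach Y (H p p) -> U Y.
Proof.
move=> UX XY YB; apply: (kohnert_reach_ind (Q := U)) XY UX => X0 r x q UX st rch.
have {}rch := kohnert_reach_trans rch YB.
case: UX st rch => -> st rch; case: (H_step _ _ st rch) => // [[/n_Sn//]|[pj ->]].
- by constructor 2.
- by constructor 3.
by rewrite ltnn in pj.
Qed.

Let reachV X Y : V X -> kohnert_reach X Y -> kohnert_reach Y (H p p) -> V Y.
Proof.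
move=> VX XY YB; apply: (kohnert_reach_ind (Q := V)) XY VX => X0 r x q VX st rch.
have {}rch := kohnert_reach_trans rch YB.
case: VX st rch => -> st rch; case: (H_step _ _ st rch) => // [[pp j ->]|[pj ->]].
- by rewrite eqxx in j.
- by constructor 2.
- by constructor 3.
- by rewrite ltnn in pj.
- by case/n_Sn: pp.
by rewrite ltnn in pj.
Qed.

Let reachT Y : kohnert_reach (H p.+1 p.+2) Y -> kohnert_reach Y (H p p) ->
  [\/ Y = H p.+1 p.+2, U Y | V Y].
Proof.
move=> TY YB; pose Q X := [\/ X = H p.+1 p.+2, U X | V X].
apply: (kohnert_reach_ind (Q := Q)) TY _; last by constructor 1.
move=> X0 r x q QX st rch; have XY := kohnert_step_reach st.
case: QX XY st rch => [->|UX|VX] XY st rch.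
- have {}rch := kohnert_reach_trans rch YB.
  case: (H_step _ _ st rch) => // [[_ _ ->]|[_ ->]]; first by constructor 2; constructor 1.
  by constructor 3; constructor 1.
- by constructor 2; apply: reachU XY (kohnert_reach_trans rch YB).
- by constructor 3; apply: reachV XY (kohnert_reach_trans rch YB).
Qed.

Let step_left j : J j -> j != p.+1 -> kohnert_reach (H p.+1 j) (H p j).
Proof.
move=> Jj jp; rewrite -(H_left p Ip1 Jj); apply: kohnert_step_reach; split.
- by rewrite HE !eqxx.
- move=> k ck; rewrite HE (negPf (row1 ck)) (gtn_eqF ck) [p.+1 == j]eq_sym (negPf jp).
  by rewrite andbF.
- by rewrite p_gt0 /=.
- by rewrite HE (negPf (IE Ip)) eqxx (ltn_eqF cc') andbF (ltn_eqF (ltnSn p)).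
- by move=> t; clear; lia.
Qed.

Let step_right i j : I i -> (j == p.+1) || (j == p.+2) -> kohnert_reach (H i j) (H i j.-1).
Proof.
move=> Ii Jj; have Jj' : J j by rewrite /J Jj orbT.
rewrite -(H_right j.-1 Ii Jj'); apply: kohnert_step_reach; split.
- by rewrite HE !eqxx orbT.
- move=> k ck; rewrite HE (gtn_eqF ck) (gtn_eqF (ltn_trans cc' ck)) !andbF /=.
  by case/orP: Jj => /eqP->; [apply: row1; apply: ltn_trans ck | apply: row2].
- by clear -Jj p_gt0; lia.
- have J1 : J j.-1 by clear -Jj; rewrite /J; lia.
  rewrite HE (negPf (JE J1)) eqxx (gtn_eqF cc') andbF orbF andbT /=.
  by clear -Jj p_gt0; lia.
- by move=> t; clear -Jj p_gt0; lia.
Qed.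

Variable D : cells.
Hypothesis reachD : kohnert_reach D (H p.+1 p.+2).

Let T_u1 := step_left Jp2 (ltac:(clear; lia)).
Let u1_u2 := step_right Ip (ltac:(by rewrite eqxx orbT) : (p.+2 == p.+1) || (p.+2 == p.+2)).
Let u2_B := step_right Ip (ltac:(by rewrite eqxx) : (p.+1 == p.+1) || (p.+1 == p.+2)).
Let T_v1 := step_right Ip1 (ltac:(by rewrite eqxx orbT) : (p.+2 == p.+1) || (p.+2 == p.+2)).
Let v1_v2 := step_right Ip1 (ltac:(by rewrite eqxx) : (p.+1 == p.+1) || (p.+1 == p.+2)).
Let v2_B := step_left Jp (ltac:(clear; lia)).

Lemma diagram_hexagon_not_multiplicity_free : ~ multiplicity_free (kohnert_poly D).
Proof.
move/multiplicity_freeP=> /(_ (H p p.+1) (H p.+1 p)) inj.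
have : H p p.+1 = H p.+1 p; first apply: inj.
- exact: kohnert_reach_trans reachD (kohnert_reach_trans T_u1 u1_u2).
- exact: kohnert_reach_trans reachD (kohnert_reach_trans T_v1 v1_v2).
- apply/eq_wt=> i; rewrite /H !big_fsetU1 ?inE ?xpair_eqE ?(ltn_eqF cc') ?andbF ?IE ?JE //=.
  by rewrite addnCA.
by move=> /H_inj[] // /n_Sn.
Qed.

Lemma diagram_hexagon : exists b u2 u1 v2 v1 t : kohnert_poset D, hexagon b u2 u1 v2 v1 t.
Proof.
have mem X : kohnert_reach (H p.+1 p.+2) X -> X \in KD D.
  by move=> r; apply/KDP; apply: kohnert_reach_trans reachD r.
have mu1 := mem _ T_u1; have mv1 := mem _ T_v1.
have mu2 := mem _ (kohnert_reach_trans T_u1 u1_u2).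
have mv2 := mem _ (kohnert_reach_trans T_v1 v1_v2).
have mb := mem _ (kohnert_reach_trans T_u1 (kohnert_reach_trans u1_u2 u2_B)).
have mt := mem _ (kohnert_reach_refl _).
pose el X (m : X \in KD D) : kohnert_poset D := [` m].
have leE (x y : kohnert_poset D) : (x <= y)%O <-> kohnert_reach (val y) (val x).
  by split=> [/asboolP|xy] //; apply/asboolP.
have ltE X Y (mX : X \in KD D) (mY : Y \in KD D) : kohnert_reach X Y -> X <> Y -> (el _ mY < el _ mX)%O.
  move=> XY nXY; rewrite lt_neqAle; apply/andP; split; last exact/leE.
  by apply/eqP=> /(congr1 val)/= e; apply: nXY.
have neq i j i' j' : I i -> J j -> I i' -> J j' -> (i != i') || (j != j') -> H i j <> H i' j'.
  by move=> Ii Jj Ii' Jj' n /H_inj[] // ei ej; rewrite ei ej !eqxx in n.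
exists (el _ mb), (el _ mu2), (el _ mu1), (el _ mv2), (el _ mv1), (el _ mt); split.
- by split; apply: ltE; rewrite ?ltn_eqF // => /H_inj[] //; clear; lia.
- by split; apply: ltE => //; apply: neq => //; clear; lia.
- move=> x /andP[/leE bx /leE xt].
  have eqv Y (mY : Y \in KD D) : val x = Y -> x == el _ mY by move=> e; apply/eqP/val_inj.
  rewrite !inE; case: (reachT xt bx) => [e|[]e|[]e]; rewrite (eqv _ _ e) ?orbT //.
have sep X Y : (X = H p p.+2) \/ (X = H p p.+1) -> (Y = H p.+1 p.+1) \/ (Y = H p.+1 p) ->
    ~ kohnert_reach X Y /\ ~ kohnert_reach Y X.
  move=> uX vY; have [XB YB] : kohnert_reach X (H p p) /\ kohnert_reach Y (H p p).
    split; [case: uX | case: vY] => ->; eauto using kohnert_reach_trans.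
  split=> [r|r].
    have UX : U X by case: uX; [constructor 1 | constructor 2].
    have := reachU UX r YB; case: vY => -> []; apply: neq => //; clear; lia.
  have VY : V Y by case: vY; [constructor 1 | constructor 2].
  have := reachV VY r XB; case: uX => -> []; apply: neq => //; clear; lia.
move=> x y xu yv; have [] := sep (val x) (val y).
- by move: xu; rewrite !inE => /orP[] /eqP->; auto.
- by move: yv; rewrite !inE => /orP[] /eqP->; auto.
by move=> nxy nyx; apply/negP=> /orP[] /leE.
Qed.

End DiagramHexagon.

End Moves.

(** * Reaching a hexagon *)

Section Lowering.
Implicit Types (D T X Y S : cells) (x y z u : cell).

(** The case [k = c'] of the condition on row [p.+1] also frees [(p.+1, c')]. Row [p] is constrained
    in the two columns only. *)
Definition hexagon_at T p c c' : Prop :=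
  [/\ c < c', 0 < p,
      [/\ (p.+1, c) \in T, (p.+2, c') \in T, (p, c) \notin T & (p, c') \notin T],
      forall k, c < k -> (p.+1, k) \notin T & forall k, c' < k -> (p.+2, k) \notin T].

Lemma hexagon_at_bad D T p c c' : kohnert_reach D T -> hexagon_at T p c c' ->
  [/\ ~ shellable (kohnert_poset D), ~ EL_shellable (kohnert_poset D)
    & ~ multiplicity_free (kohnert_poly D)].
Proof.
move=> DT [cc' p0 [aT bT pc pc'] r1 r2].
pose E := T `\ (p.+1, c) `\ (p.+2, c').
have TE : T = (p.+1, c) |` ((p.+2, c') |` E).
  by rewrite /E fsetD1K ?fsetD1K // !inE bT xpair_eqE (gtn_eqF cc') andbF.
have Ec : (p, c) \notin E /\ (p.+1, c) \notin E.
  by rewrite !inE eqxx (negPf pc) !andbF.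
have Ec' : [/\ (p, c') \notin E, (p.+1, c') \notin E & (p.+2, c') \notin E].
  by rewrite !inE eqxx (negPf pc') (negPf (r1 _ cc')) !andbF.
have R1 k : c < k -> (p.+1, k) \notin E by move=> ck; rewrite !inE (negPf (r1 _ ck)) !andbF.
have R2 k : c' < k -> (p.+2, k) \notin E by move=> ck; rewrite !inE (negPf (r2 _ ck)) !andbF.
rewrite TE in DT.
have [b [u2 [u1 [v2 [v1 [t hex]]]]]] := diagram_hexagon cc' p0 Ec Ec' R1 R2 DT.
split; first exact: hexagon_not_shellable hex.
  exact: hexagon_not_EL_shellable hex.
exact: (diagram_hexagon_not_multiplicity_free cc' p0 Ec Ec' R1 R2 DT).
Qed.

(** One move per row. The cell must be rightmost in the rows it leaves, so the landing row [e] may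
    contain cells further right. *)
Lemma slide D r c e : (r, c) \in D -> 0 < e <= r ->
  (forall t k, e < t <= r -> c < k -> (t, k) \notin D) ->
  (forall t, e <= t < r -> (t, c) \notin D) ->
  kohnert_reach D ((e, c) |` (D `\ (r, c))).
Proof.
move=> + /andP[e0 er]; rewrite -(subnK er).
elim: (r - e) D => [|m IH] D; first by move=> rD _ _; rewrite fsetD1K //; apply: kohnert_reach_refl.
rewrite addSn; move: (m + e)%N (leq_addl m e) IH => s es IH rD right free.
have sD : (s, c) \notin D by apply: free; rewrite es /=.
have st : kohnert_step D s.+1 c s.
  split=> //.
  - by move=> k; apply: right; rewrite ltnS es leqnn.
  - by rewrite (leq_trans e0 es) /=.
  - by move=> t; clear; lia.
have sE : ((s, c) |` (D `\ (s.+1, c))) `\ (s, c) = D `\ (s.+1, c).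
  by rewrite fsetU1K // !inE (negPf sD) andbF.
apply: kohnert_reach_trans (kohnert_step_reach st) _.
rewrite -[in X in kohnert_reach _ X]sE; apply: IH => [|t k tb ck|t tb]; rewrite ?inE ?eqxx //.
  rewrite (negPf (right t k _ ck)) ?andbF ?orbF ?xpair_eqE ?(gtn_eqF ck) ?andbF //.
  by case/andP: tb => -> /leqW.
case/andP: tb => et ts; rewrite (negPf (free t _)) ?et ?(leqW ts) //.
by rewrite andbF orbF xpair_eqE (ltn_eqF ts).
Qed.

(** The reading order: the last cell of a set is the lowest one of its rightmost column, the first
    is the highest one of its leftmost column. *)
Definition before (x y : cell) := (x.2 < y.2) || ((x.2 == y.2) && (y.1 <= x.1)).

Lemma before_total : total before.
Proof. by move=> x y; rewrite /before; lia. Qed.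

Lemma before_trans : transitive before.
Proof. by move=> x y z; rewrite /before; lia. Qed.

Lemma total_min (T : eqType) (R : rel T) (s : seq T) a0 : total R -> transitive R ->
  a0 \in s -> exists2 a, a \in s & forall b, b \in s -> R a b.
Proof.
move=> Rt Rtr; rewrite -(mem_sort R); have := sort_sorted Rt s.
case E: (sort R s) => [|x r] //= /(order_path_min Rtr)/allP rx _.
have inE' b : (b \in s) = (b \in x :: r) by rewrite -E mem_sort.
exists x => [|y]; rewrite inE' ?mem_head // inE => /predU1P[->|/rx //].
by have := Rt x x; rewrite orbb.
Qed.

Lemma exists_first (S : cells) x0 : x0 \in S ->
  exists2 x : cell, x \in S & forall y, y \in S -> before x y.
Proof. exact: (total_min before_total before_trans). Qed.

Lemma exists_last (S : cells) x0 : x0 \in S ->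
  exists2 x : cell, x \in S & forall y, y \in S -> before y x.
Proof.
apply: (total_min (R := fun x y => before y x)) => [x y|x y z yx zy]; first exact: before_total.
exact: before_trans zy yx.
Qed.

Definition lower d (x : cell) : cell := (x.1 - d, x.2).

(* Lowering the rightmost, lowest cell of S first keeps the hypotheses true for the rest of S. *)
Lemma lower_tail D S d : 0 < d -> S `<=` D ->
  (forall x, x \in S -> d < x.1) ->
  (forall x y, x \in S -> y \in D -> x.2 < y.2 -> (y \in S /\ y.1 <= x.1) \/ y.1 + d <= x.1) ->
  (forall x y, x \in S -> y \in D -> x.2 = y.2 -> y.1 < x.1 -> y \in S \/ y.1 + d < x.1) ->
  kohnert_reach D ((D `\` S) `|` (lower d @` S)).
Proof.
move=> d0; move: {2}(#|` S|) (erefl #|` S|) => m; elim: m D S => [|m IH] D S cS SD big right below.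
  have -> : S = fset0 by apply/cardfs0_eq.
  by rewrite fsetD0 imfset0 fsetU0; apply: kohnert_reach_refl.
have [x0 x0S] : exists x, x \in S by apply/fset0Pn; rewrite -cardfs_gt0 cS.
have [x xS xlast] := exists_last x0S; have xD := fsubsetP SD _ xS; have dx := big x xS.
have notS y : y \in S -> x.2 < y.2 \/ (x.2 = y.2 /\ y.1 < x.1) -> False.
  move=> /xlast/orP[lt|/andP[/eqP e le]] [gt|[e' gt]].
  - by have := ltn_trans lt gt; rewrite ltnn.
  - by rewrite e' ltnn in lt.
  - by rewrite e ltnn in gt.
  - by rewrite leqNgt gt in le.
have rch : kohnert_reach D (lower d x |` (D `\ x)).
  have -> : D `\ x = D `\ (x.1, x.2) by case: (x).
  apply: slide; first by case: (x) xD.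
  - by clear -dx; lia.
  - move=> t k tb xk; apply/negP=> tD; case: (right x _ xS tD xk) => [[tS _]|/=].
      by apply: notS tS _; left.
    by clear -tb dx; lia.
  move=> t tb; apply/negP=> tD; have tx : t < x.1 by clear -tb; lia.
  case: (below x _ xS tD erefl tx) => [tS|/=]; first by apply: notS tS _; right.
  by clear -tb dx; lia.
apply: kohnert_reach_trans rch _.
have x'D : lower d x \notin D.
  apply/negP=> x'D; have lt : (lower d x).1 < x.1 by rewrite /=; clear -dx d0; lia.
  case: (below x _ xS x'D erefl lt) => [x'S|/=]; first by apply: notS x'S _; right.
  by clear -dx; lia.
have x'S : lower d x \notin S by apply: contra x'D; apply: (fsubsetP SD).
have -> : (D `\` S) `|` (lower d @` S) =
    ((lower d x |` (D `\ x)) `\` (S `\ x)) `|` (lower d @` (S `\ x)).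
  rewrite -[in LHS](fsetD1K xS) imfsetU1 -/(lower d x); apply/fsetP=> y; rewrite !in_fsetE.
  case: (eqVneq y (lower d x)) => [->|_] /=.
    by rewrite (negPf x'S) andbF /= orbT.
  by case: (y == x); rewrite ?andbF.
apply: IH.
- by move: cS; rewrite (cardfsD1 x) xS => -[].
- apply/fsubsetP=> y; rewrite !in_fsetE => /andP[-> /(fsubsetP SD) ->]; exact: orbT.
- by move=> y; rewrite in_fsetD1 => /andP[_]; apply: big.
(* The new obstacle for [u] is the lowered [x]. It started no higher than [u], so it is now at least
   [d] rows below. *)
- move=> u y; rewrite !in_fsetE => /andP[ux uS] /orP[/eqP-> /=|/andP[yx yD]] uy.
    case: (right u x uS xD uy) => [[_ xu]|]; right; last by lia.
    by rewrite subnK // ltnW.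
  by case: (right u y uS yD uy) => [[yS yu]|]; [left; rewrite yx yS | right].
move=> u y; rewrite !in_fsetE => /andP[ux uS] /orP[/eqP-> /=|/andP[yx yD]] uy yu.
  right; rewrite subnK; last exact: ltnW.
  have := xlast u uS; rewrite /before uy ltnn eqxx /= leq_eqVlt => /predU1P[e|//].
  by case/negP: ux; apply/eqP; case: (u) (x) uy e => [? ?] [? ?] /= -> ->.
by case: (below u y uS yD uy yu) => [yS|]; [left; rewrite yx yS | right].
Qed.

Lemma in_lowered D S d y :
  y \in (D `\` S) `|` (lower d @` S) ->
  (y \in D /\ y \notin S) \/ exists2 x : cell, x \in S & y = lower d x.
Proof.
rewrite in_fsetU in_fsetD => /orP[/andP[yS yD]|/imfsetP[x xS ->]]; first by left.
by right; exists x.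
Qed.

(* The two cases of the theorem, with d = 1 and d = 2 respectively: in both, the cells above row d can be lowered by d. *)
Definition roomy D d : Prop :=
  ([/\ d = 1, forall x, x \in D -> 0 < x.1
    & forall x y, x \in D -> y \in D -> x.2 = y.2 -> x = y]) \/
  (d = 2 /\ forall x, x \in D -> 2 < x.1).

Lemma roomy_gt0 D d : roomy D d -> 0 < d.
Proof. by case=> [[-> _ _]|[-> _]]. Qed.

Lemma roomy_static D d x y :
  roomy D d -> x \in D -> y \in D -> d < x.1 -> y.1 <= d -> y.1 + d <= x.1.
Proof.
case=> [[-> pos _]|[-> big]] xD yD; last by have := big y yD; clear; lia.
by have := pos y yD; clear; lia.
Qed.

Lemma roomy_col D d x y :
  roomy D d -> x \in D -> y \in D -> x.2 = y.2 -> x <> y -> [/\ d = 2, 2 < x.1 & 2 < y.1].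
Proof.
by case=> [[_ _ single]|[-> big]] xD yD xy; [move/(_ (single _ _ xD yD xy)) | split; auto].
Qed.

(** From an increasing pair, pick the last possible left cell [(a, c)] and the last higher cell
    [(b, c')] to its right. Lower everything movable that is read after [(b, c')] by [d], then bring
    [(b, c')] down to row [a.+1]: the hexagon sits at [p = a.-1]. *)
Lemma inversion_hexagon D d x0 y0 : roomy D d ->
  x0 \in D -> y0 \in D -> d < x0.1 -> x0.2 < y0.2 -> x0.1 < y0.1 ->
  exists T p c c', kohnert_reach D T /\ hexagon_at T p c c'.
Proof.
move=> room x0D y0D dx0 xy0 lt0; have d0 := roomy_gt0 room.
pose inv x := (d < x.1) && has (fun y => (x.2 < y.2) && (x.1 < y.1)) D.
have invP x y : x \in D -> y \in D -> d < x.1 -> x.2 < y.2 -> x.1 < y.1 ->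
    x \in [fset x in D | inv x].
  by move=> xD yD dx xy lt; rewrite !inE /= xD /inv dx; apply/hasP; exists y; rewrite // xy.
(* By this choice the cells above row [d] to the right of column [c] have weakly decreasing rows,
   and column [c] has no cell below [(a, c)]. *)
have [[a c] aB alast] := exists_last (invP _ _ x0D y0D dx0 xy0 lt0).
move: aB; rewrite !inE /= => /andP[aD /andP[/= da /hasP[y1 y1D /andP[/= cy1 ay1]]]].
have mono x y : x \in D -> y \in D -> d < x.1 -> c < x.2 -> x.2 < y.2 -> y.1 <= x.1.
  move=> xD yD dx cx xy; rewrite leqNgt; apply/negP=> lt.
  by have := alast x (invP _ _ xD yD dx xy lt); rewrite /before /=; clear -cx; lia.
have amin t : (t, c) \in D -> a <= t.
  move=> tD; rewrite leqNgt; apply/negP=> ta.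
  have [_ _ dt] : [/\ d = 2, 2 < (a, c).1 & 2 < (t, c).1].
    by apply: (roomy_col room aD tD) => // -[e]; rewrite e ltnn in ta.
  have {}dt : d < (t, c).1.
    by case: room => [[-> _ _]|[-> big]]; [exact: ltn_trans dt | exact: big].
  have := alast _ (invP _ _ tD y1D dt cy1 (ltn_trans ta ay1)).
  by rewrite /before /=; clear -ta; lia.
pose Z := [fset y in D | (c < y.2) && (a < y.1)].
have y1Z : y1 \in Z by rewrite !inE /= y1D cy1.
have [[b c'] zZ zlast] := exists_last y1Z.
move: zZ; rewrite !inE /= => /and3P[zD cc' ab].
pose S := [fset y in D | (d < y.1) && ((c' < y.2) || ((c' == y.2) && (y.1 < b)))].
have SP y : (y \in S) = [&& y \in D, d < y.1 & (c' < y.2) || ((c' == y.2) && (y.1 < b))].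
  by rewrite !inE.
have Sa y : y \in S -> y.1 <= a.
  rewrite SP => /and3P[yD dy yz]; rewrite leqNgt; apply/negP=> ay.
  have yZ : y \in Z by rewrite !inE /= yD ay andbT; clear -yz cc'; lia.
  by have := zlast y yZ; rewrite /before /=; clear -yz; lia.
have SD : S `<=` D by apply/fsubsetP=> y; rewrite SP => /andP[].
have rch1 : kohnert_reach D ((D `\` S) `|` (lower d @` S)).
  apply: lower_tail => //.
  - by move=> x; rewrite SP => /and3P[].
  - move=> x y; rewrite !SP => /and3P[xD dx xz] yD xy.
    have [dy|yd] := ltnP d y.1; last by right; apply: (roomy_static room xD yD).
    left; split; first by rewrite yD /=; clear -xz xy; lia.
    by apply: mono => //; clear -xz cc'; lia.
  move=> x y; rewrite !SP => /and3P[xD dx xz] yD xy lt.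
  have [d2 _ dy] : [/\ d = 2, 2 < x.1 & 2 < y.1].
    by apply: (roomy_col room) => // e; rewrite e ltnn in lt.
  by left; rewrite yD d2 dy /=; clear -xz xy lt; lia.
set D1 := (D `\` S) `|` _ in rch1.
have right1 y : y \in D1 -> c' < y.2 -> y.1 < a.
  case/in_lowered=> [[yD yS]|[x xS ->]] cy.
    by move: yS; rewrite SP yD cy /= andbT; clear -da; lia.
  by have := Sa x xS; rewrite /=; clear -d0 da; lia.
(* A second cell in column [c'] forces [d = 2]. One that started in row at most [a] then ends below
   row [a.-1], leaving [(p, c')] free. *)
have col1 y : y \in D1 -> y.2 = c' -> b <= y.1 \/ y.1.+1 < a.
  case/in_lowered=> [[yD yS] cy|[x xS ->] cx].
    left; have [e|ne] := eqVneq y (b, c'); first by rewrite e.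
    have [d2 _ dy] : [/\ d = 2, 2 < (b, c').1 & 2 < y.1].
      by apply: (roomy_col room) => // e; rewrite e eqxx in ne.
    by move: yS; rewrite SP yD d2 dy cy eqxx ltnn /=; clear; lia.
  right; have xa := Sa x xS; move: xS; rewrite SP => /and3P[xD dx xz].
  have [d2 _ _] : [/\ d = 2, 2 < (b, c').1 & 2 < x.1].
    apply: (roomy_col room) => // e.
    by rewrite -e in xz; move: xz; rewrite /=; clear; lia.
  by move: xa dx; rewrite d2 /=; clear; lia.
(* Strictly between the two columns, a cell above row [d] is at least as high as [b] by [mono], and
   any other cell is in row at most [d], below [a]. *)
have mid1 y : y \in D1 -> c < y.2 -> y.1 != a.
  move=> yD1 cy; have [lt|gt|e] := ltngtP c' y.2.
  - by have := right1 y yD1 lt; clear; lia.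
  - case/in_lowered: yD1 => [[yD yS]|[x]]; last first.
      by rewrite SP => /and3P[_ _ xz] yx; move: gt; rewrite yx /=; clear -xz; lia.
    have [dy|] := ltnP d y.1; last by clear -da; lia.
    by have := mono y (b, c') yD zD dy cy gt; rewrite /=; clear -ab; lia.
  by have := col1 y yD1 (esym e); clear -ab; lia.
have SN y : y \in D -> ~~ (c' < y.2) -> (y.2 == c') ==> (b <= y.1) -> y \in D1.
  move=> yD yc yb; rewrite in_fsetU in_fsetD yD SP yD andbT orbC.
  by apply/orP; right; clear -yc yb; lia.
have aD1 : (a, c) \in D1 by apply: SN => //=; clear -cc'; lia.
have zD1 : (b, c') \in D1 by apply: SN => //=; clear; lia.
have colc t : t < a -> (t, c) \notin D1.
  move=> ta; apply/negP=> /in_lowered[[/amin]|[x]]; first by rewrite leqNgt ta.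
  by rewrite SP => /and3P[_ _ xz] [_ cx]; clear -xz cx cc'; lia.
have rch2 : kohnert_reach D1 ((a.+1, c') |` (D1 `\ (b, c'))).
  apply: slide => // [t k tb ck|t tb]; apply/negP=> tD1.
    by have := right1 _ tD1 ck; rewrite /=; clear -tb; lia.
  by have := col1 _ tD1 erefl; rewrite /=; clear -tb; lia.
have a0 : 0 < a by clear -da; lia.
exists ((a.+1, c') |` (D1 `\ (b, c'))), a.-1, c, c'; split.
  exact: kohnert_reach_trans rch1 rch2.
have D2 t k : (t, k) \in (a.+1, c') |` (D1 `\ (b, c')) ->
    (t = a.+1 /\ k = c') \/ ((t, k) \in D1 /\ (t, k) != (b, c')).
  rewrite in_fset1U in_fsetD1 => /predU1P[[-> ->]|/andP[]]; by [left | right].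
rewrite /hexagon_at prednK //; split=> //.
- by clear -da d0; lia.
- split.
  + rewrite in_fset1U in_fsetD1 aD1 andbT !xpair_eqE (ltn_eqF cc') !andbF; exact: orbT.
  + exact: fset1U1.
  + apply/negP=> /D2[[_ e]|[+ _]]; first by rewrite e ltnn in cc'.
    by apply/negP; apply: colc; rewrite prednK.
  + apply/negP=> /D2[[e _]|[/col1/(_ erefl)+ _]]; first by clear -e; lia.
    by rewrite /=; clear -ab; lia.
- move=> k ck; apply/negP=> /D2[[e _]|[/mid1/(_ ck)]]; first by clear -e; lia.
  by rewrite eqxx.
move=> k ck; apply/negP=> /D2[[_ e]|[/right1/(_ ck)]]; first by rewrite e ltnn in ck.
by rewrite /=; clear; lia.
Qed.

(** The two lowest cells of the repeated column are stacked in rows [v] and [v.+1], where [v] is the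
    top row of the next nonempty column [c']. The upper one jumps over the lower to row [v.-1],
    which makes an increasing pair with [(v, c')] and a hexagon at [p = v.-2]. *)
Lemma column_hexagon D x0 y0 z0 :
  (forall x, x \in D -> 2 < x.1) ->
  (forall x y, x \in D -> y \in D -> x.2 < y.2 -> y.1 <= x.1) ->
  x0 \in D -> y0 \in D -> z0 \in D -> x0.2 = y0.2 -> x0 <> y0 -> x0.2 < z0.2 ->
  exists T p c c', kohnert_reach D T /\ hexagon_at T p c c'.
Proof.
move=> big mono x0D y0D z0D /esym y0c xy0 cz0; have [c x0c] : exists c, x0.2 = c by exists x0.2.
rewrite x0c in y0c cz0.
pose R := [fset y in D | c < y.2].
have z0R : z0 \in R by rewrite !inE /= z0D.
(* Since the rows decrease, [v] bounds from above all rows to the right of [c] and from below all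
   rows of column [c]. *)
have [[v c'] zR zfirst] := exists_first z0R.
move: zR; rewrite !inE /= => /andP[zD cc'].
have v3 := big _ zD; rewrite /= in v3.
pose S := R `\ (v, c').
have SP y : (y \in S) = [&& y != (v, c'), y \in D & c < y.2] by rewrite !inE.
have SD : S `<=` D by apply/fsubsetP=> y; rewrite SP => /and3P[].
have Sfirst y : y \in S -> c' < y.2 \/ (c' = y.2 /\ y.1 < v).
  rewrite SP => /and3P[yz yD cy]; have yR : y \in R by rewrite !inE /= yD.
  have /orP[|/andP[/eqP/= e le]] := zfirst y yR; first by left.
  right; split=> //; rewrite ltn_neqAle le andbT; apply: contraNneq yz => yv.
  by rewrite -yv e; case: (y).
have Sv y : y \in S -> y.1 <= v.
  move=> yS; have /Sfirst[lt|[_ /ltnW//]] := yS.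
  by apply: (mono (v, c')) => //; apply: (fsubsetP SD).
have rch1 : kohnert_reach D ((D `\` S) `|` (lower 2 @` S)).
  apply: lower_tail => //.
  - by move=> x /(fsubsetP SD)/big.
  - move=> x y xS yD xy; left; split; last by apply: mono => //; apply: (fsubsetP SD).
    have := Sfirst x xS; move: xS; rewrite !SP yD => /and3P[_ _ cx] xz.
    rewrite (ltn_trans cx xy) !andbT; apply: contraTneq xy => ->.
    by rewrite /=; clear -xz; lia.
  move=> x y xS yD xy lt; left; have := Sfirst x xS; move: xS; rewrite !SP yD => /and3P[_ _ cx] xz.
  rewrite -xy cx !andbT; apply: contraTneq lt => e; move: xz xy; rewrite e /=; clear; lia.
set D1 := (D `\` S) `|` _ in rch1.
(* The strict bound for the other cells of column [c'] keeps [(v.-2, c')] free; further right,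
   reaching row [v.-2] is harmless. *)
have right1 y : y \in D1 -> c < y.2 -> [\/ y = (v, c'), y.1.+2 < v | y.1.+2 <= v /\ c' < y.2].
  case/in_lowered=> [[yD yS]|[x xS ->]] cy.
    by constructor 1; apply/eqP; move: yS; rewrite SP yD cy !andbT negbK.
  have xv := Sv x xS; have x3 := big x (fsubsetP SD _ xS).
  have [lt|[_ lt]] := Sfirst x xS; [constructor 3 | constructor 2]; rewrite /=; first split=> //.
    by clear -xv x3; lia.
  by clear -lt x3; lia.
have colc t : ((t, c) \in D1) = ((t, c) \in D).
  apply/idP/idP => [/in_lowered[[]//|[x]]|tD]; last by rewrite in_fsetU in_fsetD tD SP /= ltnn !andbF.
  by rewrite SP => /and3P[_ _ cx] [_ e]; rewrite e ltnn in cx.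
have Dv t : (t, c) \in D -> v <= t by move=> tD; apply: (mono (t, c) (v, c')).
have zD1 : (v, c') \in D1 by rewrite in_fsetU in_fsetD zD SP eqxx.
pose A := [fset y in D | y.2 == c].
have AP y : (y \in A) = (y \in D) && (y.2 == c) by rewrite !inE.
have x0A : x0 \in A by rewrite AP x0D x0c eqxx.
have [[r1 k1] + first1] := exists_last x0A; rewrite AP /= => /andP[r1D /eqP k1c].
rewrite k1c in r1D first1.
have [w wA] : exists w, w \in A `\ (r1, c).
  have [e|ne] := eqVneq x0 (r1, c); [exists y0 | exists x0]; rewrite in_fsetD1 ?ne //.
  by rewrite AP y0D y0c eqxx !andbT; apply/eqP=> e'; apply: xy0; rewrite e e'.
have [[r2 k2] + first2] := exists_last wA.
rewrite in_fsetD1 AP /= => /and3P[ne21 r2D /eqP k2c].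
rewrite k2c in ne21 r2D first2.
have min1 t : (t, c) \in D -> r1 <= t.
  by move=> tD; have := first1 (t, c); rewrite AP tD /before /= eqxx ltnn => /(_ isT).
have min2 t : (t, c) \in D -> t = r1 \/ r2 <= t.
  move=> tD; have [->|ne] := eqVneq t r1; [by left | right].
  have := first2 (t, c); rewrite in_fsetD1 AP tD xpair_eqE (negPf ne) /before /= eqxx ltnn.
  by move=> /(_ isT).
have r12 : r1 < r2.
  by rewrite ltn_neqAle min1 // andbT; apply: contraNneq ne21 => ->.
have vr1 := Dv _ r1D.
pose D2 := (v, c) |` (D1 `\ (r1, c)).
have D2P t k : ((t, k) \in D2) = ((t == v) && (k == c)) || (((t != r1) || (k != c)) && ((t, k) \in D1)).
  by rewrite in_fset1U in_fsetD1 !xpair_eqE negb_and.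
have right1' t k : (t, k) \in D1 -> c < k -> t <= v.
  by move=> tD ck; case: (right1 _ tD ck) => [[-> _]//|/=|/=[+ _]]; clear; lia.
have rch2 : kohnert_reach D1 D2.
  apply: slide; rewrite ?colc //; first by rewrite vr1 andbT; clear -v3; lia.
    by move=> t k tb ck; apply/negP=> tD; have := right1' _ _ tD ck; clear -tb; lia.
  by move=> t tb; rewrite colc; apply/negP=> /min1; clear -tb; lia.
pose D3 := (v.+1, c) |` (D2 `\ (r2, c)).
have D3P t k : ((t, k) \in D3) = ((t == v.+1) && (k == c)) || (((t != r2) || (k != c)) && ((t, k) \in D2)).
  by rewrite in_fset1U in_fsetD1 !xpair_eqE negb_and.
have right2 t k : (t, k) \in D2 -> c < k -> (t, k) \in D1.
  by move=> tD ck; move: tD; rewrite D2P (gtn_eqF ck) !andbF orbT.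
have col2 t : (t, c) \in D2 -> t = v \/ r2 <= t.
  rewrite D2P eqxx andbT orbF colc => /orP[/eqP|/andP[ne /min2[e|]]]; try by [left | right].
  by rewrite e eqxx in ne.
have rch3 : kohnert_reach D2 D3.
  apply: slide.
  - by rewrite D2P colc r2D (gtn_eqF r12) orbT.
  - by clear -vr1 r12; lia.
  - by move=> t k tb ck; apply/negP=> /right2/(_ ck)/right1'/(_ ck); clear -tb; lia.
  by move=> t tb; apply/negP=> /col2; clear -tb; lia.
(* The cell [(v, c)] cannot move past [(v, c')], which lies to its right in the same row. Row [v.+1]
   is clear to the right of [c], so the upper cell can move instead. *)
pose D4 := (v.-1, c) |` (D3 `\ (v.+1, c)).
have D4P t k : ((t, k) \in D4) = ((t == v.-1) && (k == c)) || (((t != v.+1) || (k != c)) && ((t, k) \in D3)).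
  by rewrite in_fset1U in_fsetD1 !xpair_eqE negb_and.
have right3 t k : (t, k) \in D3 -> c < k -> (t, k) \in D1.
  move=> tD ck; apply: right2 => //.
  by move: tD; rewrite D3P (gtn_eqF ck) !andbF orbT.
have col3 t : (t, c) \in D3 -> v <= t.
  rewrite D3P eqxx andbT orbF => /orP[/eqP->|/andP[_ /col2]]; first exact: leqnSn.
  by clear -r12 vr1; lia.
have rch4 : kohnert_reach D3 D4.
  apply: kohnert_step_reach; split.
  - by rewrite D3P !eqxx.
  - by move=> k ck; apply/negP=> /right3/(_ ck)/right1'/(_ ck); rewrite ltnn.
  - by clear -v3; lia.
  - by apply/negP=> /col3; clear -v3; lia.
  - move=> t tb; have -> : t = v by clear -tb; lia.
    by rewrite D3P D2P !eqxx /= andbT orbF; apply/orP; right; clear -r12 vr1; lia.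
exists D4, v.-2, c, c'; split.
  exact: kohnert_reach_trans rch1 (kohnert_reach_trans rch2 (kohnert_reach_trans rch3 rch4)).
have v2 : v.-2.+1 = v.-1 by clear -v3; lia.
have v1 : v.-1.+1 = v by clear -v3; lia.
have right4 t k : (t, k) \in D4 -> c < k -> (t, k) \in D1.
  by move=> + ck; rewrite D4P (gtn_eqF ck) !andbF orbT /= => /right3; apply.
rewrite /hexagon_at v2 v1; split=> //.
- by clear -v3; lia.
- split.
  + by rewrite D4P !eqxx.
  + by rewrite D4P D3P D2P (gtn_eqF cc') !orbT /= zD1 !orbT.
  + apply/negP; rewrite D4P eqxx andbT orbF => /orP[/eqP|/andP[_ /col3]]; clear -v3; lia.
  + apply/negP=> /right4/(_ cc')/right1/(_ cc')[[]|/=|/= [_]]; clear -v3; lia.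
- move=> k ck; apply/negP=> /right4/(_ ck)/right1/(_ ck)[[]|/=|/= []]; clear -v3; lia.
move=> k ck; apply/negP=> /right4 kD; have {}kD := kD (ltn_trans cc' ck).
case: (right1 _ kD (ltn_trans cc' ck)) => [/(congr1 snd)/= e|/=|/= [] + _]; try by clear; lia.
by rewrite e ltnn in ck.
Qed.

End Lowering.

(** * Staircase diagrams *)

Section StaircaseDiagrams.
Implicit Types (D T : cells) (x y z : cell).

(* F consists of immovable cells in row 1; the i-th of the remaining n cells lies in column c i and row w i, and only the last column may contain several of them. *)
Section Staircase.
Variables (n : nat) (c : nat -> nat) (F : cells).
Implicit Types (v w : nat -> nat).
Hypothesis c_mono : forall i, i.+1 < n -> c i <= c i.+1.
Hypothesis c_last : forall i j k, i < j -> j < k -> k < n -> c i = c j -> c k = c j.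
Hypothesis F_row : forall x, x \in F -> x.1 <= 1.
Hypothesis F_col : forall x i, x \in F -> i < n -> x.2 <> c i.

Definition staircase w : cells :=
  [fset x in (F : seq cell) ++ [seq (w i, c i) | i <- iota 0 n]].

Definition admissible w : Prop :=
  (forall i, i < n -> 0 < w i) /\
  (forall i, i.+1 < n -> w i.+1 <= w i /\ (c i = c i.+1 -> w i.+1 < w i)).

Lemma in_staircase w x :
  reflect (x \in F \/ exists2 i, i < n & x = (w i, c i)) (x \in staircase w).
Proof.
rewrite in_fset_cat !in_fset; apply: (iffP orP) => -[xF|]; try by left.
  by case/mapP=> i; rewrite mem_iota => i_n ->; right; exists i.
by case=> i i_n ->; right; apply/mapP; exists i => //; rewrite mem_iota.
Qed.

Lemma staircase_ext w w' : (forall i, i < n -> w i = w' i) -> staircase w = staircase w'.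
Proof.
move=> e; apply/fsetP=> x; apply/in_staircase/in_staircase => -[xF|[i i_n ->]]; try by left.
  by right; exists i => //; rewrite e.
by right; exists i => //; rewrite e.
Qed.

Lemma staircase_col_le i j : i <= j -> j < n -> c i <= c j.
Proof.
move/subnK <-; elim: (j - i) => // k IH; rewrite addSn => lt.
by rewrite (leq_trans (IH (ltnW lt))) // c_mono.
Qed.

Lemma admissible_le w i j : admissible w -> i <= j -> j < n -> w j <= w i.
Proof.
move=> [_ aw] /subnK <-; elim: (j - i) => // k IH; rewrite addSn => lt.
by rewrite (leq_trans _ (IH (ltnW lt))) //; case: (aw _ lt).
Qed.

Lemma admissible_lt w i j : admissible w -> i < j -> j < n -> c i = c j -> w j < w i.
Proof.
move=> aw ij jn cij; have i1n := leq_ltn_trans ij jn.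
apply: leq_ltn_trans (admissible_le aw ij jn) _; case: aw => _ /(_ i i1n)[_]; apply.
apply/eqP; rewrite eqn_leq c_mono //= cij; exact: staircase_col_le.
Qed.

Lemma admissible_inj w i j : admissible w -> i < n -> j < n ->
  w i = w j -> c i = c j -> i = j.
Proof.
move=> aw i_n jn wij cij; have [lt|lt|//] := ltngtP i j.
  by have := admissible_lt aw lt jn cij; rewrite wij ltnn.
by have := admissible_lt aw lt i_n (esym cij); rewrite wij ltnn.
Qed.

Lemma sum_staircase w (r : nat) : admissible w ->
  \sum_(x <- staircase w) (x.1 == r) =
  (\sum_(x <- F) (x.1 == r) + count_mem r [seq w i | i <- iota 0 n])%N.
Proof.
move=> aw; have us : uniq ((F : seq cell) ++ [seq (w i, c i) | i <- iota 0 n]).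
  rewrite cat_uniq fset_uniq map_inj_in_uniq ?iota_uniq ?andbT /=; last first.
    by move=> i j; rewrite !mem_iota => i_n jn [wij cij]; apply: (admissible_inj aw).
  apply/hasPn=> x /mapP[i]; rewrite mem_iota => i_n ->; apply/negP=> xF.
  by apply: (F_col xF i_n).
have pm : perm_eq (staircase w) ((F : seq cell) ++ [seq (w i, c i) | i <- iota 0 n]).
  by apply: uniq_perm => // x; rewrite [LHS]in_fset.
rewrite (perm_big _ pm) big_cat /=; congr addn.
by rewrite big_map -sum1_count big_map [RHS]big_mkcond; apply: eq_bigr => i _ /=; case: eqP.
Qed.

(** [F] contributes equally to both weights, so they fix the multiset of the entries, and an
    admissible vector is its own decreasing rearrangement. *)
Lemma wt_staircase_inj w w' : admissible w -> admissible w' ->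
  wt (staircase w) = wt (staircase w') -> forall i, i < n -> w i = w' i.
Proof.
move=> aw aw' /eq_wt e.
have pm : perm_eq [seq w i | i <- iota 0 n] [seq w' i | i <- iota 0 n].
  by apply/allP=> r _ /=; have := e r; rewrite !sum_staircase // => /addnI->.
have srt u : admissible u -> sorted geq [seq u i | i <- iota 0 n].
  move=> [_ au]; rewrite sorted_map; apply/(sortedP 0) => i; rewrite size_iota => lt.
  by rewrite /= !nth_iota ?(ltnW lt) //; case: (au i lt).
have gt : transitive geq by move=> a b k ba ak; apply: leq_trans ak ba.
have ga : antisymmetric geq by move=> a b; rewrite andbC => /anti_leq.
have /eq_in_map E := sorted_eq gt ga (srt _ aw) (srt _ aw') pm.
by move=> i i_n; apply: E; rewrite mem_iota.
Qed.

(* A cell jumping over a block of its column amounts to lowering the whole block by one. *)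
Lemma staircase_step w (r x q : nat) : admissible w -> kohnert_step (staircase w) r x q ->
  exists w', [/\ admissible w', forall i, i < n -> w' i <= w i
    & (q, x) |` (staircase w `\ (r, x)) = staircase w'].
Proof.
move=> aw [rx right qr qx btw]; have [pos dec] := aw.
have [i i_n [ri xi]] : exists2 i, i < n & (r, x) = (w i, c i).
  by case/in_staircase: rx => // /F_row /=; clear -qr; lia.
have last_i k : i < k -> k < n -> w k < r.
  move=> ik kn; rewrite ri ltn_neqAle admissible_le ?(ltnW ik) // andbT.
  apply/eqP=> wk; have := staircase_col_le (ltnW ik) kn.
  rewrite leq_eqVlt => /predU1P[cik|lt].
    by have := admissible_lt aw ik kn cik; rewrite wk ltnn.
  have := right (c k); rewrite xi => /(_ lt) /in_staircase[].
  by right; exists k; rewrite // ri wk.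
pose m k := (c k == x) && (q < w k <= r).
have mem_block t : q < t <= r -> exists2 k, k < n & w k = t /\ c k = x.
  case/andP=> qt; rewrite leq_eqVlt => /predU1P[->|tr]; first by exists i.
  have /in_staircase[tF|[k kn [-> ->]]] := btw t (ltac:(by rewrite qt)); last by exists k.
  by case: (F_col tF i_n); rewrite /= xi.
exists (fun k => w k - m k); split.
- split=> [k kn|k kn]; first by have := pos k kn; rewrite /m; clear -qr; lia.
  have [le lt] := dec k kn; have k0 := pos _ (ltnW kn); have k1 := pos _ kn.
  have [mk|nmk] := boolP (m k); last by split; [move: le | move=> /lt]; clear; lia.
  case/andP: (mk) => /eqP ckx wkr.
  have [mk1|nmk1] := boolP (m k.+1); first by split; [move: le | move=> /lt]; clear -k0 k1; lia.
  suff : w k.+1 < w k - 1 \/ (w k.+1 < w k /\ c k <> c k.+1) by clear; lia.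
  have [e|ne] := eqVneq (c k.+1) x.
    left; have {}lt := lt (etrans ckx (esym e)).
    have nq : w k.+1 <> q.
      move=> eq; case/in_staircase: qx; right; exists k.+1 => //.
      by rewrite eq e.
    by move: nmk1; rewrite /m e eqxx /=; clear -lt wkr nq; lia.
  (* The next entry lies in another column. This happens only when [k] is the moving index [i],
     whose successors are in lower rows by [last_i]: before [i] the columns are squeezed to [x], and
     after [i] the repeated column is the last one. *)
  right; split; last by rewrite ckx; apply/eqP; rewrite eq_sym.
  have [ki|ik|e] := ltngtP k i; last by have := last_i k.+1; rewrite ri -e; apply.
    have := staircase_col_le ki i_n; have := c_mono kn; rewrite ckx -xi => h1 h2.
    by case/eqP: ne; apply/eqP; rewrite eqn_leq h1 h2.
  case/eqP: ne; rewrite (c_last ik (ltnSn k) kn) //; by rewrite ckx.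
- by move=> k _; rewrite leq_subr.
apply/fsetP=> -[t y]; apply/idP/idP.
  rewrite in_fset1U in_fsetD1 => /orP[/eqP[-> ->]|/andP[ne /in_staircase[tF|[k kn [tk yk]]]]].
  (* The new cell is the block member of row [q.+1] shifted down; likewise a surviving member in row
     [t] is the shift of the one in row [t.+1]. *)
  - have [k kn [wk ck]] := mem_block q.+1 (ltac:(clear -qr; lia)).
    apply/in_staircase; right; exists k; rewrite // /m ck wk eqxx /=.
    by congr pair; clear -qr; lia.
  - by apply/in_staircase; left.
  apply/in_staircase; right; have [mk|nmk] := boolP (m k); last first.
    by exists k; rewrite // (negPf nmk) subn0 tk yk.
  case/andP: mk => /eqP ck qwk.
  have [k' k'n [wk' ck']] := mem_block t.+1 (ltac:(move: ne; rewrite xpair_eqE tk yk ck eqxx andbT; clear -qwk; lia)).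
  exists k'; rewrite // /m ck' wk' eqxx yk ck; congr pair.
  by move: ne; rewrite xpair_eqE tk yk ck eqxx andbT; clear -qwk; lia.
case/in_staircase=> [tF|[k kn [-> ->]]]; rewrite in_fset1U in_fsetD1 !xpair_eqE.
  have yx : y != x by rewrite xi; apply/eqP; apply: (F_col tF i_n).
  by rewrite (negPf yx) !andbF /=; apply/in_staircase; left.
have [mk|nmk] := boolP (m k).
  case/andP: mk => /eqP-> qwk; rewrite eqxx !andbT.
  have [//|neq] /= := eqVneq (w k - 1) q; apply/andP; split; first by clear -qwk; lia.
  by apply: btw; clear -qwk neq; lia.
rewrite subn0; apply/orP; right; apply/andP; split; last by apply/in_staircase; right; exists k.
apply: contra nmk => /andP[/eqP wr /eqP cx]; rewrite /m cx eqxx wr.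
by clear -qr; lia.
Qed.

Lemma staircase_reach v T : admissible v -> kohnert_reach (staircase v) T ->
  exists w, [/\ admissible w, forall i, i < n -> w i <= v i & T = staircase w].
Proof.
move=> av vT; pose Q X := exists w, [/\ admissible w, forall i, i < n -> w i <= v i & X = staircase w].
apply: (kohnert_reach_ind (Q := Q)) vT _; last by exists v.
move=> X r x q [w [aw wv ->]] st _; have [w' [aw' w'w ->]] := staircase_step aw st.
by exists w'; split=> // i i_n; apply: leq_trans (w'w i i_n) (wv i i_n).
Qed.

(** Lower by one the last entry [i] that is still too high. The later entries already agree with
    [w], hence are at most [w i], which is below [v i]: nothing stands to the right in row [v i],
    and the place below is free. *)
Lemma reach_staircase v w : admissible v -> admissible w -> (forall i, i < n -> w i <= v i) ->
  kohnert_reach (staircase v) (staircase w).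
Proof.
move: {2}(\sum_(i < n) (v i - w i)).+1 (ltnSn (\sum_(i < n) (v i - w i))) => m.
elim: m v => // m IH v bnd av aw wv.
have [/existsP[i0 lt0]|/existsPn no] := boolP [exists i : 'I_n, w i < v i]; last first.
  rewrite (@staircase_ext v w) => [|i i_n]; first exact: kohnert_reach_refl.
  by apply/eqP; rewrite eqn_leq wv // andbT leqNgt (no (Ordinal i_n)).
pose P i := (i < n) && (w i < v i).
have exP : exists i, P i by exists i0; rewrite /P ltn_ord lt0.
have bdP i : P i -> i <= n by case/andP=> /ltnW.
case: (ex_maxnP exP bdP) => i /andP[i_n lt] imax.
have eqk k : i < k -> k < n -> v k = w k.
  move=> ik kn; apply/eqP; rewrite eqn_leq wv // andbT leqNgt; apply/negP=> l.
  by have := imax k; rewrite /P kn l leqNgt ik => /(_ isT).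
have wi0 : 0 < w i by case: aw => + _; apply.
have st : kohnert_step (staircase v) (v i) (c i) (v i).-1.
  split.
  - by apply/in_staircase; right; exists i.
  - move=> k ck; apply/negP=> /in_staircase[/F_row/=|[j jn [vj kj]]].
      by clear -lt wi0; lia.
    rewrite kj in ck; have [ij|ji] := ltnP i j; last first.
      by have := staircase_col_le ji i_n; rewrite leqNgt ck.
    have := admissible_le aw (ltnW ij) jn; rewrite -(eqk j ij jn) -vj.
    by clear -lt; lia.
  - by clear -lt wi0; lia.
  - apply/negP=> /in_staircase[xF|[j jn [vj cj]]]; first exact: (F_col xF i_n).
    have [ij|ji|e] := ltngtP i j.
    + have := admissible_lt aw ij jn cj; rewrite -(eqk j ij jn) -vj.
      by clear -lt; lia.
    + by have := admissible_le av (ltnW ji) i_n; rewrite -vj; clear -lt; lia.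
    + by move: vj; rewrite -e; clear -lt; lia.
  - by move=> t; clear; lia.
pose v' k := v k - (k == i).
have av' : admissible v'.
  split=> [k kn|k kn]; rewrite /v'.
    by case: eqP => [->|_]; [clear -lt wi0; lia | rewrite subn0; case: av => + _; apply].
  have [le ltc] : v k.+1 <= v k /\ (c k = c k.+1 -> v k.+1 < v k) by case: av => _; apply.
  case: (eqVneq k i) => [ki|_]; last first.
    by split; [move: le | move=> /ltc]; clear; lia.
  have e : v k.+1 = w k.+1 by apply: eqk; rewrite // ki.
  have [wle wlt] : w k.+1 <= w k /\ (c k = c k.+1 -> w k.+1 < w k) by case: aw => _; apply.
  rewrite e; rewrite ki in wle wlt *.
  by split; [move: wle | move=> /wlt]; clear -lt; lia.
have vE : ((v i).-1, c i) |` (staircase v `\ (v i, c i)) = staircase v'.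
  apply/fsetP=> x; rewrite in_fset1U in_fsetD1; apply/idP/in_staircase.
    case/orP=> [/eqP->|/andP[ne /in_staircase[xF|[k kn xk]]]]; [|by left|].
      by right; exists i; rewrite // /v' eqxx subn1.
    right; exists k => //; rewrite /v' xk; case: eqP => [e|_]; last by rewrite subn0.
    by rewrite xk e eqxx in ne.
  case=> [xF|[k kn ->]].
    apply/orP; right; apply/andP; split; last by apply/in_staircase; left.
    by apply/eqP=> e; apply: (F_col xF i_n); rewrite e.
  rewrite /v'; have [->|ki] := eqVneq k i; first by rewrite subn1 eqxx.
  rewrite subn0; apply/orP; right; apply/andP; split; last by apply/in_staircase; right; exists k.
  by apply: contra ki => /eqP[vk ck]; rewrite (admissible_inj av kn i_n vk ck).
apply: kohnert_reach_trans (kohnert_step_reach st) _; rewrite vE; apply: IH => //.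
  rewrite -ltnS; apply: leq_trans bnd; rewrite ltnS (bigD1 (Ordinal i_n)) //=.
  rewrite [leqRHS](bigD1 (Ordinal i_n)) //= -addSn leq_add //.
    by rewrite /v' eqxx; clear -lt; lia.
  by apply: leq_sum => k _; rewrite /v'; clear; lia.
move=> k kn; rewrite /v'; case: eqP => [->|_]; last by rewrite subn0 wv.
by clear -lt; lia.
Qed.

Variable v : nat -> nat.
Hypothesis adm_v : admissible v.
Let P := kohnert_poset (staircase v).

Let coordP (X : P) : exists w, [/\ admissible w, forall i, i < n -> w i <= v i
  & val X = staircase w].
Proof. by apply: staircase_reach => //; apply/KDP; apply: valP. Qed.

(** A choice, because a diagram says nothing about entries from [n] on; below [n] it is unique by
    [wt_staircase_inj]. *)
Let coord (X : P) : nat -> nat := sval (cid (coordP X)).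

Let coord_adm X : admissible (coord X).
Proof. by rewrite /coord; case: cid => /= w []. Qed.

Let coord_le X i : i < n -> coord X i <= v i.
Proof. by rewrite /coord; case: cid => /= w [_ + _]; apply. Qed.

Let coordE X : val X = staircase (coord X).
Proof. by rewrite /coord; case: cid => /= w []. Qed.

Let coord_onto w : admissible w -> (forall i, i < n -> w i <= v i) ->
  exists X : P, forall i, i < n -> coord X i = w i.
Proof.
move=> aw wv; have wD : staircase w \in KD (staircase v) by apply/KDP; apply: reach_staircase.
exists [` wD]; apply: wt_staircase_inj => //.
by rewrite -coordE.
Qed.

Let coord_leP (X Y : P) : (X <= Y)%O <-> (forall i, i < n -> coord X i <= coord Y i).
Proof.
split=> [/asboolP|le]; last by apply/asboolP; rewrite !coordE; apply: reach_staircase.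
rewrite [val Y]coordE => /(staircase_reach (coord_adm Y))[w [aw wY Xw]] i i_n.
rewrite (@wt_staircase_inj (coord X) w) //; first exact: wY.
by rewrite -coordE Xw.
Qed.

(** The raised entry stays compatible with its left neighbour because that neighbour has the same
    value in [Y], whose [i]-th entry is at least as large. *)
Let coord_raise (X Y : P) i : (X <= Y)%O -> i < n -> coord X i < coord Y i ->
  (forall k, k < i -> coord X k = coord Y k) ->
  exists Z, forall k, k < n -> coord Z k = (coord X k + (k == i))%N.
Proof.
move=> _ i_n lt eqs; have [Xpos Xdec] := coord_adm X; have [_ Ydec] := coord_adm Y.
apply: (coord_onto (w := fun k => (coord X k + (k == i))%N)) => [|k kn]; last first.
  case: eqP => [->|_]; last by rewrite addn0 coord_le.
  by rewrite addn1 (leq_trans lt) ?coord_le.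
split=> [k kn|k kn]; first by rewrite ltn_addr ?Xpos.
have [le ltc] := Xdec k kn; have [leY ltY] := Ydec k kn.
case: (eqVneq k.+1 i) => [ki|_]; last by split; [move: le | move=> /ltc]; clear; lia.
have e : coord X k = coord Y k by apply: eqs; rewrite -ki.
have -> : (k == i) = false by rewrite -ki ltn_eqF.
rewrite e; rewrite -ki in lt.
by split; [move: leY | move=> /ltY]; clear -lt; lia.
Qed.

(** Admissible vectors are closed under componentwise minimum, so an element of least coordinate sum
    lies below all others. *)
Let staircase_poset_bounded : bounded P.
Proof.
have topD : staircase v \in KD (staircase v) by apply/KDP; apply: kohnert_reach_refl.
split; last first.
  by exists [` topD] => X; apply/asboolP; apply/KDP; apply: valP.
pose total (X : P) := \sum_(i < n) coord X i.
case: (@arg_minnP _ ([` topD] : P) xpredT total isT) => B _ Bmin.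
exists B => X; apply/coord_leP => i i_n.
have [BX|XB] := leqP (coord B i) (coord X i); first by [].
have [|k kn|Z ZE] := @coord_onto (fun k => minn (coord B k) (coord X k)).
- have [Bpos Bdec] := coord_adm B; have [Xpos Xdec] := coord_adm X.
  split=> [k kn|k kn]; first by rewrite leq_min Bpos ?Xpos.
  have [leB ltB] := Bdec k kn; have [leX ltX] := Xdec k kn.
  split=> [|/[dup]/ltB + /ltX]; first by move: leB leX; clear; lia.
  by clear; lia.
- by rewrite geq_min coord_le.
have := Bmin Z isT; rewrite leqNgt => /negP[].
rewrite /total (bigD1 (Ordinal i_n)) //= [X in _ < X](bigD1 (Ordinal i_n)) //= -addSn.
rewrite leq_add //; first by rewrite ZE // gtn_min XB orbT.
by apply: leq_sum => k _; rewrite ZE // geq_minl.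
Qed.

Lemma staircase_EL_shellable : EL_shellable P.
Proof. exact: vector_poset_EL_shellable coord_leP coord_raise staircase_poset_bounded. Qed.

Lemma staircase_shellable : shellable P.
Proof. exact: vector_poset_shellable coord_leP coord_raise staircase_poset_bounded. Qed.

Lemma staircase_multiplicity_free : multiplicity_free (kohnert_poly (staircase v)).
Proof.
apply/multiplicity_freeP=> T X /(staircase_reach adm_v)[w [aw _ ->]].
case/(staircase_reach adm_v)=> w' [aw' _ ->] e.
by apply: staircase_ext; apply: wt_staircase_inj.
Qed.

End Staircase.

(** The vector lists the cells above row [d] in reading order, and [F] collects the rest: row 1 when
    [d = 1], nothing when [d = 2]. *)
Lemma staircase_representation D d : roomy D d ->
  (forall x y, x \in D -> y \in D -> d < x.1 -> x.2 < y.2 -> y.1 <= x.1) ->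
  (forall x y z, x \in D -> y \in D -> z \in D -> d < z.1 ->
     x.2 = y.2 -> x <> y -> z.2 <= x.2) ->
  exists n c F v, [/\ D = staircase n c F v, admissible n c v,
    forall i, i.+1 < n -> c i <= c i.+1,
    forall i j k, i < j -> j < k -> k < n -> c i = c j -> c k = c j
  & (forall x, x \in F -> x.1 <= 1) /\ (forall x i, x \in F -> i < n -> x.2 <> c i)].
Proof.
move=> room mono lastc; have d0 := roomy_gt0 room.
pose A := [fset x in D | d < x.1]; pose s := sort before (A : seq cell).
have AP x : (x \in A) = (x \in D) && (d < x.1) by rewrite !inE.
have sP x : (x \in s) = (x \in D) && (d < x.1) by rewrite mem_sort -AP.
have us : uniq s by rewrite sort_uniq fset_uniq.
pose a := nth (0, 0) s; pose n := size s.
have aD i : i < n -> a i \in D /\ d < (a i).1.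
  by move=> i_n; apply/andP; rewrite -sP mem_nth.
have ab i j : i < j -> j < n -> before (a i) (a j).
  move=> ij jn; apply: (sorted_ltn_nth before_trans) => //; last exact: ltn_trans jn.
  exact: (sort_sorted before_total).
have ane i j : i < j -> j < n -> a i <> a j.
  by move=> ij jn; apply/eqP; rewrite nth_uniq // ?(ltn_eqF ij) // (ltn_trans ij).
have acol i j : i < j -> j < n -> (a i).2 <= (a j).2.
  by move=> ij jn; case/orP: (ab i j ij jn) => [/ltnW|/andP[/eqP-> _]].
exists n, (fun i => (a i).2), [fset x in D | x.1 <= d], (fun i => (a i).1); split.
- apply/fsetP=> x; apply/idP/in_staircase.
    move=> xD; have [xd|dx] := leqP x.1 d; first by left; rewrite !inE /= xD.
    right; have xs : x \in s by rewrite sP xD.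
    exists (index x s); first by rewrite index_mem.
    by rewrite /a nth_index //; case: (x).
  case=> [|[i i_n ->]]; first by rewrite !inE => /andP[].
  by have [+ _] := aD i i_n; case: (a i).
- split=> [i i_n|i i_n]; first by have [_] := aD i i_n; clear; lia.
  have [aiD di] := aD i (ltnW i_n); have [ajD _] := aD _ i_n.
  have := ab i i.+1 (ltnSn i) i_n; have ne := ane i i.+1 (ltnSn i) i_n.
  case/orP=> [lt|/andP[/eqP e le]].
    by split; [apply: mono | move=> e; rewrite e ltnn in lt].
  split=> // _; rewrite ltn_neqAle le andbT; apply/eqP=> e1.
  by apply: ne; case: (a i) (a i.+1) e e1 => [? ?] [? ?] /= -> ->.
- by move=> i i_n; apply: acol.
- move=> i j k ij jk kn cij; have jn := ltn_trans jk kn.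
  have [aiD _] := aD i (ltn_trans ij jn); have [ajD _] := aD j jn; have [akD dk] := aD k kn.
  have := lastc _ _ _ aiD ajD akD dk cij (ane i j ij jn).
  rewrite cij => le; apply/eqP; rewrite eqn_leq le /=; exact: acol.
split=> [x|x i].
  rewrite !inE => /andP[/= xD]; case: room => [[-> _ _]//|[-> big]] xd.
  by have := leq_trans (big x xD) xd.
rewrite !inE => /andP[/= xD xd] i_n e; have [aiD di] := aD i i_n.
have ne : x <> a i by move=> xa; move: xd; rewrite xa leqNgt di.
have [d2 x3 _] := roomy_col room xD aiD e ne.
by move: xd x3; rewrite d2; clear; lia.
Qed.

End StaircaseDiagrams.

Theorem theorem4p15 (D : {fset nat * nat}) (hD : is_diagram D)
  (h : (forall x y : nat * nat, x \in D -> y \in D -> x.2 = y.2 -> x = y) \/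
       (forall x : nat * nat, x \in D -> x.1 <> 1 /\ x.1 <> 2)) :
  (shellable (kohnert_poset D) <-> EL_shellable (kohnert_poset D)) /\
  (EL_shellable (kohnert_poset D) <-> multiplicity_free (kohnert_poly D)).
Proof.
have [d room] : exists d, roomy D d.
  case: h => [single|empty]; [exists 1; left | exists 2; right].
    by split=> // x /hD[].
  split=> // x xD; have [x0 _] := hD x xD; have [x1 x2] := empty x xD.
  by clear -x0 x1 x2; lia.
(* The equivalences come from a dichotomy: the three properties hold together or fail together,
   according to whether a hexagon is reachable. *)
suff [[? ? ?]|[? ? ?]] :
    [/\ shellable (kohnert_poset D), EL_shellable (kohnert_poset D)
      & multiplicity_free (kohnert_poly D)] \/
    [/\ ~ shellable (kohnert_poset D), ~ EL_shellable (kohnert_poset D)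
      & ~ multiplicity_free (kohnert_poly D)] by tauto.
pose hexagonal := exists T p c c', kohnert_reach D T /\ hexagon_at T p c c'.
have [[T [p [c [c' [DT hex]]]]]|nhex] := pselect hexagonal.
  by right; apply: hexagon_at_bad DT hex.
have mono (x y : cell) : x \in D -> y \in D -> d < x.1 -> x.2 < y.2 -> y.1 <= x.1.
  move=> xD yD dx xy; rewrite leqNgt; apply/negP=> lt; apply: nhex.
  exact: inversion_hexagon room xD yD dx xy lt.
have lastc (x y z : cell) : x \in D -> y \in D -> z \in D -> d < z.1 ->
    x.2 = y.2 -> x <> y -> z.2 <= x.2.
  move=> xD yD zD _ xy ne; rewrite leqNgt; apply/negP=> lt; apply: nhex.
  have [d2 _ _] := roomy_col room xD yD xy ne.
  have big (u : cell) : u \in D -> 2 < u.1 by case: room => [[d1 _ _]|[_]]; [rewrite d1 in d2 | apply].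
  apply: (column_hexagon big _ xD yD zD xy ne lt) => u w uD wD.
  by apply: mono => //; rewrite d2; apply: big.
have [n [c [F [v [-> av cm cl [Fr Fc]]]]]] := staircase_representation room mono lastc.
left; split.
- exact: staircase_shellable av.
- exact: staircase_EL_shellable av.
- exact: staircase_multiplicity_free av.
Qed.
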